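(* The solution of the Blaschke-Lebesgue problem in $\mathbb{R}^3$ is not a body of revolution. That is, if $B\subset\mathbb{R}^3$ is a constant width convex body which minimizes the ratio $$\mathcal{I}(B)=\frac{\text{volume of } B}{\text{volume of a ball of the same width as } B}$$ among all constant width convex bodies in $\mathbb{R}^3$, then $B$ is not a body of revolution.
   Context: A convex body in $\mathbb{R}^3$ is a compact convex set with nonempty interior. The width of a convex body $B$ in the direction of a unit vector $\vec u$ is the distance between the two supporting planes of $B$ orthogonal to $\vec u$; $B$ has constant width if this number does not depend on $\vec u$, and the common value is then called the width of $B$. A ball of radius $w$ has width $2w$. A body of revolution is a convex body invariant under all rotations around some line. The Blaschke-Lebesgue problem is the determination of the minimizer of $\mathcal{I}$ among constant width bodies. *)

(* Defs.v *)
From HB Require Import structures.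
From mathcomp Require Import all_boot all_order all_algebra.
From mathcomp Require Import all_classical all_reals all_analysis.

Set Implicit Arguments.
Unset Strict Implicit.
Unset Printing Implicit Defensive.

Import Order.TTheory GRing.Theory Num.Theory.
Import numFieldNormedType.Exports.

Local Open Scope classical_set_scope.
Local Open Scope ring_scope.

(* The library norm on 'rV[R]_3 is the sup norm; it induces the usual topology
   (used below for compactness and interior) but not the Euclidean metric. *)
Definition dotp (R : realType) (x y : 'rV[R]_3) : R :=
  \sum_(i < 3) x 0 i * y 0 i.

Definition enorm (R : realType) (x : 'rV[R]_3) : R := Num.sqrt (dotp x x).

Definition edistance (R : realType) (A B : set 'rV[R]_3) : R :=
  inf [set d | exists x y, [/\ A x, B y & d = enorm (x - y)]].

Definition eball (R : realType) (c : 'rV[R]_3) (r : R) : set 'rV[R]_3 :=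
  [set x | enorm (x - c) <= r].

Definition point3 (R : realType)
    (p : measurableTypeR R * measurableTypeR R * measurableTypeR R) :
    'rV[R]_3 :=
  \row_(i < 3) nth 0 [:: p.1.1 : R; p.1.2 : R; p.2 : R] i.

(* [fine] loses nothing on bounded Borel sets, whose measure is finite. *)
Definition volume (R : realType) (B : set 'rV[R]_3) : R :=
  fine (((@lebesgue_measure R \x @lebesgue_measure R) \x @lebesgue_measure R)%E
          (@point3 R @^-1` B)).

Definition convex_body (R : realType) (B : set 'rV[R]_3) : Prop :=
  [/\ compact B,
      convex_set (B : set (convex_lmodType 'rV[R]_3)) &
      interior B !=set0].

(* The supporting plane of B with outer normal u. The two supporting planes
   orthogonal to u are those with outer normals u and - u. *)
Definition support_plane (R : realType) (B : set 'rV[R]_3) (u : 'rV[R]_3) :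
    set 'rV[R]_3 :=
  [set x | dotp x u = sup [set dotp y u | y in B]].

Definition width_in_direction (R : realType) (B : set 'rV[R]_3)
    (u : 'rV[R]_3) : R :=
  edistance (support_plane B u) (support_plane B (- u)).

Definition has_constant_width (R : realType) (B : set 'rV[R]_3) (w : R) : Prop :=
  forall u : 'rV[R]_3, enorm u = 1 -> width_in_direction B u = w.

Definition constant_width_body (R : realType) (B : set 'rV[R]_3) : Prop :=
  convex_body B /\ exists w : R, has_constant_width B w.

(* The common value of the widths; meaningful when B has constant width. *)
Definition width (R : realType) (B : set 'rV[R]_3) : R :=
  get [set w | has_constant_width B w].

(* A ball of radius r has width 2r. *)
Definition volume_ratio (R : realType) (B : set 'rV[R]_3) : R :=
  volume B / volume (eball 0 (width B / 2)).

(* Matrices act on row vectors from the right. *)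
Definition rotation_matrix_about (R : realType) (v : 'rV[R]_3) (A : 'M[R]_3) :
    Prop :=
  [/\ A *m A^T = 1%:M, \det A = 1 & v *m A = v].

(* Invariance under all rotations about the line p + R v. *)
Definition body_of_revolution (R : realType) (B : set 'rV[R]_3) : Prop :=
  convex_body B /\
  exists p v : 'rV[R]_3, v != 0 /\
    forall A : 'M[R]_3, rotation_matrix_about v A ->
      (fun x => p + (x - p) *m A) @` B = B.

(* Main.v *)
(* The minimizer [B] is compared with a completion [C] of the set of vertices of a
   regular tetrahedron of edge [w], where [w] is the width of [B]. A maximal set of
   diameter [w] is the intersection of the balls of radius [w] centred at its points and
   has constant width [w], so [C] lies in the Reuleaux tetrahedron, whose volume is
   0.4221... w^3 and is bounded here by [1130 / 2560 * w^3] with a cover by boxes.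

   A body of revolution of constant width [w] has a larger volume. After a rotation the
   axis is vertical; rotations preserve the volume because plane rotations are products
   of shears. In units of [w], let [(a, t)] and [(c - a, t - s)] be the points of the half
   profile with outer normals [(c, s)] and [(c, - s)], where [c^2 + s^2 = 1], and put
   [b = a - c / 2]. Adding up horizontal discs gives
     volume = pi * (1 / 6 - int_0^1 b^2 / s^2 ds) with |b| <= min(c, 1 - c) / 2,
   whose minimum 0.4494... w^3 belongs to the rotated Reuleaux triangle. The profile need
   not be smooth, so the integration is carried out on finite increments with errors of
   second order; with rounded constants it gives [313 / 100 * (353 / 2500) * w^3]. *)

Require Import Defs.
From Stdlib Require Import ZArith.
From HB Require Import structures.
From mathcomp Require Import all_boot all_order all_algebra.
From mathcomp Require Import all_classical all_reals all_analysis.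
From mathcomp Require Import measurable_realfun ring lra zify ssrZ.

Set Implicit Arguments.
Unset Strict Implicit.
Unset Printing Implicit Defensive.
Import Order.TTheory GRing.Theory Num.Theory.
Import numFieldNormedType.Exports.

Local Open Scope classical_set_scope.
Local Open Scope ring_scope.

(** * Invariance of Lebesgue measure under rigid motions *)

(** The Reuleaux tetrahedron itself does not have constant width, so a body of constant width inside
    it has to be produced. Any completion of the vertices will do, because only an upper bound on
    its volume is wanted. The gap between 0.4221 and 0.4494 leaves room for crude arithmetic: the
    two rounded bounds are about 0.44141 and 0.44196. The volume formula is an integration by parts.
    With [tau = t - s / 2], the discs contribute [a^2 dt + (c - a)^2 (ds - dt) = (c^2 / 4 + b^2) ds
    + 2 b c dtau]. The support conditions amount to [c db + s dtau = 0], so the last term is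
    [- (c^2 / s) d(b^2)]. Since [c^2 / s = 1 / s - s], moving the differential onto this factor
    leaves [- b^2 / s^2 ds] and a boundary term. *)

Section measure.
Variable R : realType.
Let mR := measurableTypeR R.
Let mu : set mR -> \bar R := @lebesgue_measure R.

(* A named constant, because the structures inferred for a term [m1 \x m2] do not
   include sigma-finiteness. *)
Definition lebesgue2 : set (measurableTypeR R * measurableTypeR R) -> \bar R :=
  (@lebesgue_measure R \x @lebesgue_measure R)%E.
HB.instance Definition _ := Measure.on lebesgue2.

Lemma lebesgue2_sigma_finite : sigma_finite setT lebesgue2.
Proof.
pose I n : set mR := `[- n%:R, n%:R]%classic.
have mI n : measurable (I n) by exact: measurable_itv.
exists (fun n => I n `*` I n).
  apply/esym/seteqP; split => // -[x y] _.
  exists (maxn (Num.bound `|x|) (Num.bound `|y|)) => //=.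
  have b (u : R) n : (Num.bound `|u| <= n)%N -> I n u.
    rewrite -(ler_nat R) => un; rewrite /I /= in_itv /= -ler_norml.
    by apply: le_trans un; apply/ltW/archi_boundP.
  by split; apply: b; rewrite ?leq_maxl ?leq_maxr.
move=> n; split; first exact: measurableX.
rewrite [X in (X < _)%E]product_measure1E//= lebesgue_measure_itv /=.
by case: ifP => _; rewrite ?mule0 ?mul0e ?ltry// -EFinB -EFinM ltry.
Qed.

HB.instance Definition _ := Measure_isSigmaFinite.Build _ _ _ lebesgue2 lebesgue2_sigma_finite.

Lemma lebesgue_measure_shift (a : R) (A : set mR) : measurable A ->
  mu ((fun x : mR => x + a : mR) @^-1` A) = mu A.
Proof.
move=> mA.
have ms : measurable_fun [set: mR] (fun x : mR => x + a : mR).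
  by apply: measurable_funD.
have := @lebesgue_measure_unique R (pushforward mu (fun x : mR => x + a : mR)).
move=> /(_ ms) U; apply/esym/(U _ A mA) => X [[u v] /= uv <-].
rewrite /pushforward.
have -> : (fun x : mR => x + a : mR) @^-1` `]u, v]%classic = `]u - a, v - a]%classic.
  by apply/seteqP; split => x /=; rewrite !in_itv /= ltrBlDr lerBrDr.
rewrite /mu !lebesgue_measure_itv /= !lte_fin ltrD2r.
by case: ifP => // _; rewrite -!EFinB; congr EFin; ring.
Qed.

Lemma shear2_measure (f : mR -> mR) (A : set (mR * mR)) : measurable A ->
  lebesgue2 ((fun p => (p.1, p.2 + f p.1)) @^-1` A) = lebesgue2 A.
Proof.
move=> mA; apply: eq_integral => x _ /=.
apply: etrans (lebesgue_measure_shift (f x) (measurable_xsection x mA)).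
by congr (mu _); apply/seteqP; split => y /=; rewrite /xsection /= !inE.
Qed.

(** One kind of shear preserves vertical lines and the other horizontal lines, so sections along
    both axes are required. *)
Lemma lebesgue2_swapE (A : set (mR * mR)) : measurable A ->
  lebesgue2 A = (@lebesgue_measure R \x^ @lebesgue_measure R)%E A.
Proof.
move=> mA; apply: product_measure_unique => // X Y mX mY.
exact: product_measure2E.
Qed.

Lemma shear1_measure (f : mR -> mR) (A : set (mR * mR)) :
  measurable_fun setT f -> measurable A ->
  lebesgue2 ((fun p => (p.1 + f p.2, p.2)) @^-1` A) = lebesgue2 A.
Proof.
move=> mf mA.
rewrite !lebesgue2_swapE//; last first.
  rewrite -[_ @^-1` _]setTI; apply: (_ : measurable_fun setT _) => //.
  apply: measurable_fun_pair; last exact: measurable_snd.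
  apply: measurable_funD; first exact: measurable_fst.
  exact: measurableT_comp mf measurable_snd.
apply: eq_integral => y _ /=.
apply: etrans (lebesgue_measure_shift (f y) (measurable_ysection y mA)).
by congr (mu _); apply/seteqP; split => x /=; rewrite /ysection /= !inE.
Qed.

Definition rot2 (c s : R) (p : mR * mR) : mR * mR :=
  (c * p.1 - s * p.2, s * p.1 + c * p.2).

Lemma measurable_shear2 (k : R) :
  measurable_fun setT (fun p : mR * mR => (p.1, p.2 + k * p.1) : mR * mR).
Proof.
apply: measurable_fun_pair; first exact: measurable_fst.
apply: measurable_funD; first exact: measurable_snd.
by apply: measurable_funM => //; exact: measurable_fst.
Qed.

Lemma measurable_shear1 (k : R) :
  measurable_fun setT (fun p : mR * mR => (p.1 + k * p.2, p.2) : mR * mR).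
Proof.
apply: measurable_fun_pair; last exact: measurable_snd.
apply: measurable_funD; first exact: measurable_fst.
by apply: measurable_funM => //; exact: measurable_snd.
Qed.

(* A plane rotation is a product of three shears. *)
Lemma rot2_measure (c s : R) (A : set (mR * mR)) :
  c ^+ 2 + s ^+ 2 = 1 -> 0 <= c -> measurable A ->
  lebesgue2 (rot2 c s @^-1` A) = lebesgue2 A.
Proof.
(* For the angle theta, [s / (1 + c)] is tan(theta / 2); [0 <= c] keeps the denominator positive. *)
move=> cs1 c0 mA; pose k : R := - (s / (1 + c)).
pose h1 := fun p : mR * mR => (p.1 + k * p.2, p.2) : mR * mR.
pose h2 := fun p : mR * mR => (p.1, p.2 + s * p.1) : mR * mR.
have c1 : 1 + c != 0 by apply/lt0r_neq0; lra.
have -> : rot2 c s = h1 \o h2 \o h1.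
  have E : s * s = (1 + c) * (1 - c) by rewrite -[LHS]/(s ^+ 2); nra.
  have K : k * s = c - 1.
    transitivity (- (s * s) / (1 + c)); first by rewrite /k; field.
    by rewrite E; field.
  have K2 : k * (2 + k * s) = - s.
    by rewrite K /k; field.
  apply/funext => -[x y]; rewrite /rot2 /h1 /h2 /=; congr (_, _).
    transitivity ((1 + k * s) * x + k * (2 + k * s) * y); last by ring.
    by rewrite K2 K; ring.
  transitivity (s * x + (1 + k * s) * y); last by ring.
  by rewrite K; ring.
have m1 : measurable (h1 @^-1` A).
  by rewrite -[_ @^-1` _]setTI; apply: measurable_shear1.
have m2 : measurable (h2 @^-1` (h1 @^-1` A)).
  by rewrite -[_ @^-1` _]setTI; apply: measurable_shear2.
rewrite !comp_preimage.
rewrite (shear1_measure _ m2); last by apply: measurable_funM.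
rewrite (shear2_measure (fun x => s * x) m1).
by rewrite (shear1_measure _ mA)//; apply: measurable_funM.
Qed.

End measure.
Arguments lebesgue2 {R} _.

Section measure3.
Variable R : realType.
Let mR := measurableTypeR R.
Let mu : set mR -> \bar R := @lebesgue_measure R.
Definition lebesgue3 : set (measurableTypeR R * measurableTypeR R * measurableTypeR R) -> \bar R :=
  (@lebesgue2 R \x @lebesgue_measure R)%E.
HB.instance Definition _ := Measure.on lebesgue3.

Lemma lebesgue3_ysectionE (A : set (mR * mR * mR)) : measurable A ->
  lebesgue3 A = (\int[@lebesgue_measure R]_z lebesgue2 (ysection A z))%E.
Proof.
move=> mA.
have E : forall X Y, measurable X -> measurable Y ->
    (@lebesgue2 R \x^ @lebesgue_measure R)%E (X `*` Y) = (lebesgue2 X * @lebesgue_measure R Y)%E.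
  exact: product_measure2E.
have := @product_measure_unique _ _ _ _ R (@lebesgue2 R) (@lebesgue_measure R) _ E _ mA.
by [].
Qed.

(** The triple product is bracketed to the left, so slicing by the first coordinate takes Tonelli's
    theorem on the base [mR * mR]. The map [rotYZ] acts inside these slices. *)
Lemma lebesgue3_xsectionE (A : set (mR * mR * mR)) : measurable A ->
  lebesgue3 A = (\int[@lebesgue_measure R]_x lebesgue2 [set p | A (x, p.1, p.2)])%E.
Proof.
move=> mA.
have mf := measurable_fun_xsection (@lebesgue_measure R) mA.
have f0 (p : mR * mR) : (0 <= (@lebesgue_measure R \o xsection A) p)%E by [].
transitivity (\int[@lebesgue_measure R]_x fubini_F (@lebesgue_measure R)
    (@lebesgue_measure R \o xsection A) x)%E.
  exact: (@fubini_tonelli1 _ _ _ _ R (@lebesgue_measure R) (@lebesgue_measure R) _ mf f0).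
apply: eq_integral => x _; rewrite /fubini_F /product_measure1.
by apply: eq_integral.
Qed.

Definition rotXY (c s : R) (p : mR * mR * mR) : mR * mR * mR :=
  (rot2 c s p.1, p.2).

Definition rotYZ (c s : R) (p : mR * mR * mR) : mR * mR * mR :=
  (p.1.1, (rot2 c s (p.1.2, p.2)).1, (rot2 c s (p.1.2, p.2)).2).

Lemma measurable_linear_form (a b d : R) :
  measurable_fun setT (fun p : mR * mR * mR => a * p.1.1 + b * p.1.2 + d * p.2 : mR).
Proof.
have m1 := @measurable_fst _ _ (mR * mR)%type mR.
have m2 := @measurable_snd _ _ (mR * mR)%type mR.
apply: measurable_funD; last by apply: measurable_funM => //.
apply: measurable_funD; apply: measurable_funM => //.
  exact: measurableT_comp (@measurable_fst _ _ mR mR) m1.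
exact: measurableT_comp (@measurable_snd _ _ mR mR) m1.
Qed.

Lemma measurable_rotXY c s : measurable_fun setT (rotXY c s).
Proof.
rewrite (_ : rotXY c s = fun p => (c * p.1.1 + - s * p.1.2 + 0 * p.2 : mR,
   s * p.1.1 + c * p.1.2 + 0 * p.2 : mR, 0 * p.1.1 + 0 * p.1.2 + 1 * p.2 : mR)).
  by apply: measurable_fun_pair; [apply: measurable_fun_pair|];
    exact: measurable_linear_form.
by apply/funext => -[[x y] z]; rewrite /rotXY /rot2 /= !mul0r !addr0 ?add0r mul1r mulNr.
Qed.

Lemma measurable_rotYZ c s : measurable_fun setT (rotYZ c s).
Proof.
rewrite (_ : rotYZ c s = fun p => (1 * p.1.1 + 0 * p.1.2 + 0 * p.2 : mR,
   0 * p.1.1 + c * p.1.2 + - s * p.2 : mR, 0 * p.1.1 + s * p.1.2 + c * p.2 : mR)).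
  by apply: measurable_fun_pair; [apply: measurable_fun_pair|];
    exact: measurable_linear_form.
by apply/funext => -[[x y] z]; rewrite /rotYZ /rot2 /= !mul0r ?addr0 ?add0r mul1r mulNr.
Qed.

Lemma rotXY_measure (c s : R) (A : set (mR * mR * mR)) :
  c ^+ 2 + s ^+ 2 = 1 -> 0 <= c -> measurable A ->
  lebesgue3 (rotXY c s @^-1` A) = lebesgue3 A.
Proof.
move=> cs1 c0 mA.
have mB : measurable (rotXY c s @^-1` A).
  by rewrite -[_ @^-1` _]setTI; apply: measurable_rotXY.
rewrite (lebesgue3_ysectionE mA) (lebesgue3_ysectionE mB).
apply: eq_integral => z _.
apply: etrans (rot2_measure cs1 c0 (measurable_ysection z mA)).
by congr lebesgue2; apply/seteqP; split => p /=; rewrite /ysection /= !inE.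
Qed.

Lemma rotYZ_measure (c s : R) (A : set (mR * mR * mR)) :
  c ^+ 2 + s ^+ 2 = 1 -> 0 <= c -> measurable A ->
  lebesgue3 (rotYZ c s @^-1` A) = lebesgue3 A.
Proof.
move=> cs1 c0 mA.
have mB : measurable (rotYZ c s @^-1` A).
  by rewrite -[_ @^-1` _]setTI; apply: measurable_rotYZ.
rewrite (lebesgue3_xsectionE mA) (lebesgue3_xsectionE mB).
apply: eq_integral => x _.
have mAx : measurable [set p : mR * mR | A (x, p.1, p.2)].
  rewrite (_ : [set p | _] = (fun p => (x : mR, p.1, p.2)) @^-1` A)//.
  rewrite -[_ @^-1` _]setTI; apply: (_ : measurable_fun setT _) => //.
  apply: measurable_fun_pair; last exact: measurable_snd.
  by apply: measurable_fun_pair => //; exact: measurable_fst.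
apply: etrans (rot2_measure cs1 c0 mAx).
by congr lebesgue2; apply/seteqP; split => -[y z].
Qed.

Lemma translation_measure (a b d : R) (A : set (mR * mR * mR)) : measurable A ->
  lebesgue3 ((fun p => (p.1.1 + a, p.1.2 + b, p.2 + d)) @^-1` A) = lebesgue3 A.
Proof.
move=> mA.
pose f := fun p : mR * mR * mR => (p.1.1 + a : mR, p.1.2 + b : mR, p.2 : mR).
have mfA : measurable (f @^-1` A).
  rewrite -[_ @^-1` _]setTI; apply: (_ : measurable_fun setT f) => //.
  have m1 := @measurable_fst _ _ (mR * mR)%type mR.
  apply: measurable_fun_pair; last exact: measurable_snd.
  apply: measurable_fun_pair; apply: measurable_funD => //.
    exact: measurableT_comp (@measurable_fst _ _ mR mR) m1.
  exact: measurableT_comp (@measurable_snd _ _ mR mR) m1.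
transitivity (lebesgue3 (f @^-1` A)).
  apply: eq_integral => p _ /=.
  apply: etrans (lebesgue_measure_shift d (measurable_xsection p mfA)).
  by congr (mu _); apply/seteqP; split => z /=; rewrite /xsection /= !inE.
rewrite (lebesgue3_ysectionE mA) (lebesgue3_ysectionE mfA).
apply: eq_integral => z _.
have mz := measurable_ysection z mA.
have msz : measurable ((fun p : mR * mR => (p.1, p.2 + b) : mR * mR) @^-1` ysection A z).
  rewrite -[_ @^-1` _]setTI; apply: (_ : measurable_fun setT _) => //.
  apply: measurable_fun_pair; first exact: measurable_fst.
  by apply: measurable_funD => //; exact: measurable_snd.
apply: etrans (shear2_measure (cst b) mz).
apply: etrans (shear1_measure (@measurable_cst _ _ mR mR _ a) msz).
by congr (lebesgue2 _); apply/seteqP; split => p /=; rewrite /ysection /= !inE.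
Qed.

End measure3.
Arguments lebesgue3 {R} _.

(** * Coordinates and frames *)

Section coordinates.
Variable R : realType.
Let mR := measurableTypeR R.

Definition vec (x y z : R) : 'rV[R]_3 := point3 (x : mR, y : mR, z : mR).

Lemma vecE (x y z : R) : (vec x y z 0 0 = x) * (vec x y z 0 1 = y) * (vec x y z 0 2%:R = z).
Proof. by rewrite /vec /point3 !mxE. Qed.

Lemma vecP (u : 'rV[R]_3) : u = vec (u 0 0) (u 0 1) (u 0 2%:R).
Proof.
apply/rowP => i; rewrite /vec /point3 mxE.
by case: i => -[|[|[|//]]] h /=; congr (u 0 _); apply/val_inj.
Qed.

Lemma sum3E (F : 'I_3 -> R) : \sum_(i < 3) F i = F 0 + F 1 + F 2%:R.
Proof.
rewrite !big_ord_recr big_ord0 /= add0r.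
by congr (F _ + F _ + F _); apply/val_inj.
Qed.

Lemma dotpE (u v : 'rV[R]_3) : dotp u v = u 0 0 * v 0 0 + u 0 1 * v 0 1 + u 0 2%:R * v 0 2%:R.
Proof. by rewrite /dotp sum3E. Qed.

Lemma dotp_vec x y z x' y' z' :
  dotp (vec x y z) (vec x' y' z') = x * x' + y * y' + z * z'.
Proof. by rewrite dotpE !vecE. Qed.

(** An open set is the union of the boxes with rational centre and radius [1 / (n + 1)] that it
    contains, and these are countably many. *)
Lemma measurable_point3_open (U : set 'rV[R]_3) : open U ->
  measurable (@point3 R @^-1` U).
Proof.
move=> oU.
pose box (p : rat * rat * rat * nat) : set (mR * mR * mR) :=
  let e := p.2.+1%:R^-1 : R in
  (`]ratr p.1.1.1 - e, ratr p.1.1.1 + e[%classic `*`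
   `]ratr p.1.1.2 - e, ratr p.1.1.2 + e[%classic) `*`
   `]ratr p.1.2 - e, ratr p.1.2 + e[%classic.
have mbox p : measurable (box p).
  by apply: measurableX; [apply: measurableX|]; exact: measurable_itv.
rewrite (_ : _ @^-1` _ =
  \bigcup_(p in [set p | box p `<=` @point3 R @^-1` U]) box p); last first.
  apply/seteqP; split=> [[[x y] z] /= Ux|q [p bp]]; last exact: bp.
  have /nbhs_ballP[e /= e0 eU] := open_nbhs_nbhs (conj oU Ux).
  (* The box contains the given point but is centred at a rational one, so its points are within
     twice its radius of the given point. *)
  have [n ne] : exists n : nat, n.+1%:R^-1 < e / 2.
    exists (Num.bound (e / 2)^-1).
    have b0 : 0 < (e / 2)^-1 by rewrite invr_gt0 divr_gt0.
    rewrite -[ltRHS]invrK ltf_pV2 ?posrE//.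
    by rewrite (lt_le_trans (archi_boundP (ltW b0)))// ler_nat.
  have [d dE] : exists d : R, d = n.+1%:R^-1 by exists n.+1%:R^-1.
  have n0 : 0 < d by rewrite dE invr_gt0.
  rewrite -dE in ne.
  have ap (u : R) : exists r : rat, `|u - ratr r| < d.
    have [|r] := @rat_in_itvoo R (u - d) (u + d); first by lra.
    by rewrite in_itv /= => /andP[a b]; exists r; rewrite ltr_norml; lra.
  have [r1 h1] := ap x; have [r2 h2] := ap y; have [r3 h3] := ap z.
  exists (r1, r2, r3, n).
    move=> [[x' y'] z'] [[/= a1 a2] a3]; apply: eU.
    split=> // i j; rewrite !mxE /ball /=.
    move: a1 a2 a3; rewrite /= -dE !in_itv /= => /andP[? ?] /andP[? ?] /andP[? ?].
    move: h1 h2 h3; rewrite !ltr_norml => /andP[? ?] /andP[? ?] /andP[? ?].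
    by case: j => -[|[|[|//]]] h /=; lra.
  move: h1 h2 h3; rewrite !ltr_norml => /andP[? ?] /andP[? ?] /andP[? ?].
  by split; [split|] => /=; rewrite -dE in_itv /=; lra.
rewrite bigcup_mkcond; apply: countable_bigcupT_measurable => // p.
by case: ifPn.
Qed.

Lemma measurable_point3_closed (U : set 'rV[R]_3) : closed U ->
  measurable (@point3 R @^-1` U).
Proof.
move=> cU; rewrite -[U]setCK preimage_setC; apply: measurableC.
by apply: (@measurable_point3_open (~` U)); exact: closed_openC.
Qed.

End coordinates.

Section frame.
Variable R : realType.
Let mR := measurableTypeR R.

Lemma vecD (x y z x' y' z' : R) :
  vec x y z + vec x' y' z' = vec (x + x') (y + y') (z + z').
Proof. by rewrite [LHS]vecP !mxE. Qed.

Lemma vecZ (k x y z : R) : k *: vec x y z = vec (k * x) (k * y) (k * z).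
Proof. by rewrite [LHS]vecP !mxE. Qed.

Lemma vecN (x y z : R) : - vec x y z = vec (- x) (- y) (- z).
Proof. by rewrite [LHS]vecP !mxE. Qed.

Lemma vecB (x y z x' y' z' : R) :
  vec x y z - vec x' y' z' = vec (x - x') (y - y') (z - z').
Proof. by rewrite vecN vecD. Qed.

Definition mx3 (r0 r1 r2 : 'rV[R]_3) : 'M[R]_3 :=
  \matrix_(i < 3) nth 0 [:: r0; r1; r2] i.

Lemma vec_mx3 x y z (r0 r1 r2 : 'rV[R]_3) :
  vec x y z *m mx3 r0 r1 r2 = x *: r0 + y *: r1 + z *: r2.
Proof. by apply/rowP => j; rewrite !mxE sum3E !vecE !mxE. Qed.

Definition rotXYmx (c s : R) := mx3 (vec c s 0) (vec (- s) c 0) (vec 0 0 1).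
Definition rotYZmx (c s : R) := mx3 (vec 1 0 0) (vec 0 c s) (vec 0 (- s) c).

Lemma vec_rotXYmx c s x y z : vec x y z *m rotXYmx c s = vec (c * x - s * y) (s * x + c * y) z.
Proof. by rewrite vec_mx3 !vecZ !vecD; congr vec; ring. Qed.

Lemma vec_rotYZmx c s x y z : vec x y z *m rotYZmx c s = vec x (c * y - s * z) (s * y + c * z).
Proof. by rewrite vec_mx3 !vecZ !vecD; congr vec; ring. Qed.

Lemma mx3_eq1 (M : 'M[R]_3) : (forall x y z, vec x y z *m M = vec x y z) -> M = 1%:M.
Proof.
move=> H; apply/row_matrixP => i; rewrite !rowE mulmx1.
by rewrite [delta_mx _ _]vecP H.
Qed.

Lemma tr_rotXYmx c s : (rotXYmx c s)^T = rotXYmx c (- s).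
Proof.
apply/matrixP => -[[|[|[|//]]] hi] -[[|[|[|//]]] hj].
all: by rewrite /rotXYmx /mx3 /vec /point3 !mxE /= ?mxE /= ?opprK.
Qed.

Lemma tr_rotYZmx c s : (rotYZmx c s)^T = rotYZmx c (- s).
Proof.
apply/matrixP => -[[|[|[|//]]] hi] -[[|[|[|//]]] hj].
all: by rewrite /rotYZmx /mx3 /vec /point3 !mxE /= ?mxE /= ?opprK.
Qed.

Lemma rotXYmx_orthogonal c s : c ^+ 2 + s ^+ 2 = 1 -> rotXYmx c s *m (rotXYmx c s)^T = 1%:M.
Proof.
move=> cs; apply: mx3_eq1 => x y z; rewrite tr_rotXYmx mulmxA !vec_rotXYmx.
congr vec.
  by transitivity ((c ^+ 2 + s ^+ 2) * x); [ring|rewrite cs mul1r].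
by transitivity ((c ^+ 2 + s ^+ 2) * y); [ring|rewrite cs mul1r].
Qed.

Lemma rotYZmx_orthogonal c s : c ^+ 2 + s ^+ 2 = 1 -> rotYZmx c s *m (rotYZmx c s)^T = 1%:M.
Proof.
move=> cs; apply: mx3_eq1 => x y z; rewrite tr_rotYZmx mulmxA !vec_rotYZmx.
congr vec.
  by transitivity ((c ^+ 2 + s ^+ 2) * y); [ring|rewrite cs mul1r].
by transitivity ((c ^+ 2 + s ^+ 2) * z); [ring|rewrite cs mul1r].
Qed.

Lemma det_rotXYmx c s : c ^+ 2 + s ^+ 2 = 1 -> \det (rotXYmx c s) = 1.
Proof.
move=> cs.
rewrite (expand_det_row _ 2%:R) sum3E /cofactor /= !(expand_det_row _ 0).
rewrite !big_ord_recr !big_ord0 /= /cofactor !det_mx11 !mxE /=.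
rewrite -[((1 %% 3 + 1 %% 3) %% 3)%N]/2%N /= -[1%R in RHS]cs; ring.
Qed.

Lemma polar_coordinates (x y : R) : 0 <= x -> exists c s r,
  [/\ c ^+ 2 + s ^+ 2 = 1, 0 <= c, x = r * c & y = r * s].
Proof.
move=> x0; pose r := Num.sqrt (x ^+ 2 + y ^+ 2).
have rr : r ^+ 2 = x ^+ 2 + y ^+ 2 by rewrite sqr_sqrtr// addr_ge0// sqr_ge0.
have [r0|rN0] := eqVneq r 0.
  have /eqP : x ^+ 2 + y ^+ 2 = 0 by rewrite -rr r0 expr0n.
  rewrite paddr_eq0 ?sqr_ge0// !sqrf_eq0 => /andP[/eqP -> /eqP ->].
  by exists 1, 0, 0; split; rewrite ?mul0r// ?ler01// ?expr1n ?expr0n /= ?addr0.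
exists (x / r), (y / r), r; split => //.
- by rewrite !expr_div_n -mulrDl -rr divff// sqrf_eq0.
- by rewrite divr_ge0// sqrtr_ge0.
- by rewrite mulrCA divff ?mulr1.
- by rewrite mulrCA divff ?mulr1.
Qed.

(* Two plane rotations take the third axis to the line spanned by [v]. *)
Lemma exists_frame (v : 'rV[R]_3) : v != 0 ->
  exists O : 'M[R]_3, [/\ O *m O^T = 1%:M,
    exists k, v = k *: (vec 0 0 1 *m O) &
    forall (p : 'rV[R]_3) (B : set 'rV[R]_3), closed B ->
      measurable (@point3 R @^-1` [set q | B (p + q *m O)]) /\
      lebesgue3 (@point3 R @^-1` [set q | B (p + q *m O)]) =
      lebesgue3 (@point3 R @^-1` B)].
Proof.
(* [rot2_measure] covers only angles with nonnegative cosine. Replacing [v] by [- v] keeps the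
   line. *)
wlog v3 : v / 0 <= v 0 2%:R.
  move=> W v0; have [/W|v3] := lerP 0 (v 0 2%:R); first exact.
  have [||O [OO [k kE] H]] := W (- v); rewrite ?oppr_eq0// ?mxE ?oppr_ge0 ?ltW//.
  by exists O; split => //; exists (- k); rewrite scaleNr -kE opprK.
move=> _; rewrite {1}[v]vecP.
(* Here the cosine is kept nonnegative by allowing a negative radius [r]. *)
have [c1 [s1 [r [cs1 c10 [e1 e2]]]]] : exists c s r,
    [/\ c ^+ 2 + s ^+ 2 = 1, 0 <= c & - v 0 1 = r * c /\ v 0 0 = r * s].
  have [a|a] := lerP 0 (- v 0 1).
    have [c [s [r [? ? ? ?]]]] := polar_coordinates (v 0 0) a.
    by exists c, s, r.
  have [|c [s [r [? ? e e']]]] := @polar_coordinates (v 0 1) (- v 0 0).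
    by rewrite -oppr_le0 ltW.
  exists c, s, (- r); split => //; split; rewrite mulNr; first by rewrite e.
  by rewrite -e' opprK.
have [c2 [s2 [k [cs2 c20 e3 e4]]]] := polar_coordinates r v3.
exists (rotYZmx c2 s2 *m rotXYmx c1 s1); split.
- rewrite trmx_mul mulmxA -(mulmxA _ _ (rotXYmx c1 s1)^T) rotXYmx_orthogonal// mulmx1.
  exact: rotYZmx_orthogonal.
- exists k; rewrite mulmxA vec_rotYZmx vec_rotXYmx vecZ -[v 0 1]opprK e1 e2 e3 e4.
  by congr vec; ring.
move=> p B cB.
have mB := measurable_point3_closed cB.
pose B1 := (fun q : mR * mR * mR => (q.1.1 + p 0 0 : mR, q.1.2 + p 0 1 : mR, q.2 + p 0 2%:R : mR))
  @^-1` (@point3 R @^-1` B).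
have mB1 : measurable B1.
  rewrite /B1 -[_ @^-1` _]setTI; apply: (_ : measurable_fun setT _) => //.
  have m1 := @measurable_fst _ _ (mR * mR)%type mR.
  apply: measurable_fun_pair; last first.
    by apply: measurable_funD => //; exact: measurable_snd.
  apply: measurable_fun_pair; apply: measurable_funD => //.
    exact: measurableT_comp (@measurable_fst _ _ mR mR) m1.
  exact: measurableT_comp (@measurable_snd _ _ mR mR) m1.
have mB2 : measurable (rotXY c1 s1 @^-1` B1).
  by rewrite -[_ @^-1` _]setTI; apply: measurable_rotXY.
have mB3 : measurable (rotYZ c2 s2 @^-1` (rotXY c1 s1 @^-1` B1)).
  by rewrite -[_ @^-1` _]setTI; apply: measurable_rotYZ.
have -> : @point3 R @^-1` [set q | B (p + q *m (rotYZmx c2 s2 *m rotXYmx c1 s1))] =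
    rotYZ c2 s2 @^-1` (rotXY c1 s1 @^-1` B1).
  apply/seteqP; split => -[[x y] z] /=;
    rewrite mulmxA -[point3 _]/(vec x y z) vec_rotYZmx vec_rotXYmx {1}[p]vecP vecD;
    by rewrite /B1 /= /rotXY /rotYZ /rot2 /= -[point3 _]/(vec _ _ _) ![_ + p _ _]addrC.
split; first exact: mB3.
apply: etrans (translation_measure (p 0 0) (p 0 1) (p 0 2%:R) mB).
apply: etrans (rotXY_measure cs1 c10 mB1).
exact: rotYZ_measure cs2 c20 mB2.
Qed.

End frame.

(** * The energy estimate for the profile *)

Section core.
Variable R : realType.

(** With [n] equal steps the errors add up to [K * (b - a) ^+ 2 / n], which tends to 0. This takes
    the place of integrating a derivative and asks for no regularity of [f]. *)
Lemma sub_quadratic_error_le (f : R -> R) (a b K : R) : a <= b ->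
  (forall x y, a <= x -> x < y -> y <= b -> f x - K * (y - x) ^+ 2 <= f y) ->
  f a <= f b.
Proof.
move=> ab H; apply/ler_addgt0Pr => e e0.
have [->|aNb] := eqVneq a b; first by rewrite lerDl ltW.
pose L := (`|K| * (b - a) ^+ 2) / e.
have [n nL n0] : exists2 n, L <= n%:R & (0 : R) < n%:R.
  have L0 : 0 <= L by apply: divr_ge0; [apply: mulr_ge0; rewrite ?sqr_ge0|exact: ltW].
  exists (Num.bound L).+1; last by rewrite ltr0n.
  by rewrite (le_trans (ltW (archi_boundP L0)))// ler_nat.
pose d := (b - a) / n%:R.
have d0 : 0 < d by rewrite divr_gt0// subr_gt0 lt_neqAle aNb.
have nd : n%:R * d = b - a by rewrite /d mulrC divfK// gt_eqF.
have step k : (k <= n)%N -> f a - k%:R * (K * d ^+ 2) <= f (a + k%:R * d).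
  elim: k => [|k IH] kn; first by rewrite !mul0r subr0 addr0.
  have kdn : k.+1%:R * d <= n%:R * d by rewrite ler_wpM2r ?ler_nat// ltW.
  have kd0 : 0 <= k%:R * d by rewrite mulr_ge0// ltW.
  have := H (a + k%:R * d) (a + k.+1%:R * d).
  rewrite -[k.+1%:R]natr1 in kdn *.
  rewrite (_ : a + (k%:R + 1) * d - (a + k%:R * d) = d); last by ring.
  have := IH (ltnW kn); lra.
have := step n (leqnn n); rewrite nd (addrC a) subrK => S.
suff E : n%:R * (K * d ^+ 2) <= e by lra.
have nLe : `|K| * (b - a) ^+ 2 <= n%:R * e by rewrite -ler_pdivrMr.
rewrite -(ler_pM2l n0) (_ : n%:R * (n%:R * (K * d ^+ 2)) = K * (n%:R * d) ^+ 2); last by ring.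
by rewrite nd (le_trans _ nLe)// ler_wpM2r ?sqr_ge0// ler_norm.
Qed.

Lemma ger_Nprod (x y M N : R) : `|x| <= M -> `|y| <= N -> - (M * N) <= x * y.
Proof.
move=> hx hy; have : `|x * y| <= M * N by rewrite normrM ler_pM.
by rewrite ler_norml => /andP[].
Qed.

(* [si], [g], [be] and [ta] are the increments of [s], [c], [b = a - c / 2] and
   [t - s / 2] in [profile_step]. *)
Lemma energy_step (s0 k s c b si g be ta K : R) :
  0 < s0 -> 0 <= k -> s0 <= s -> 0 < si -> s + si <= 1 -> 0 < c -> c <= 1 ->
  c ^+ 2 = 1 - s ^+ 2 -> (c + g) ^+ 2 = 1 - (s + si) ^+ 2 ->
  `|g| <= k * si -> `|be| <= k / 2 * si -> `|ta| <= si / 2 ->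
  `|b| <= 1 / 2 -> `|b + be| <= 1 / 2 ->
  `|c * be + s * ta| <= (g ^+ 2 + si ^+ 2) / 4 ->
  K = 1 / 4 + k + (1 + k ^+ 2) / (4 * s0) + k / (2 * s0 ^+ 2) ->
  - (si * b ^+ 2 / s ^+ 2) - K * si ^+ 2 <=
  si * ((c + g) ^+ 2 / 4 + (b + be) ^+ 2) + 2 * ta * ((c + g) * (b + be))
  + ((1 - (s + si) ^+ 2) / (s + si) * (b + be) ^+ 2 - (1 - s ^+ 2) / s * b ^+ 2)
  - si / 4 + ((s + si) ^+ 3 - s ^+ 3) / 12.
Proof.
move=> s00 k0 s0s hsi s'1 c_gt0 c1 cE c'E hg hbe hta hb hb' hep ->.
have s_gt0 : 0 < s by lra.
have s'_gt0 : 0 < s + si by lra.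
have i0 : 0 < s0^-1 by rewrite invr_gt0.
have hs : s^-1 <= s0^-1 by rewrite lef_pV2.
have hcb : `|(c + g) * (b + be) - c * b| <= k * si.
  rewrite (_ : (c + g) * (b + be) - c * b = g * (b + be) + c * be); last by ring.
  apply: le_trans (ler_normD _ _) _; rewrite !normrM (gtr0_norm c_gt0).
  have : `|g| * `|b + be| <= k * si * (1 / 2) by rewrite ler_pM.
  have : c * `|be| <= 1 * (k / 2 * si) by rewrite ler_pM// ltW.
  lra.
have hbb : `|(b + be) ^+ 2 - b ^+ 2| <= k / 2 * si.
  rewrite (_ : (b + be) ^+ 2 - b ^+ 2 = be * ((b + be) + b)); last by ring.
  rewrite normrM -[leRHS]mulr1; apply: ler_pM => //.
  by apply: le_trans (ler_normD _ _) _; lra.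
(* The errors [e1] to [e4] correspond to the four summands of [K]: freezing [s] in the integral of
   [c^2 / 4], freezing [c * b] in the cross term, replacing [ta] by [- c / s * be], and freezing
   [b ^+ 2] against the increment of [1 / s]. The terms in [e5] and [e6] have a favourable sign. *)
have e1 : - (1 / 4 * si ^+ 2) <= - si * (s + si) ^+ 2 / 4
    + si * ((s + si) ^+ 2 + (s + si) * s + s ^+ 2) / 12.
  rewrite -subr_ge0.
  rewrite (_ : - si * (s + si) ^+ 2 / 4 + si * ((s + si) ^+ 2 + (s + si) * s + s ^+ 2) / 12
    - - (1 / 4 * si ^+ 2) = si ^+ 2 * (3 - (2 * (s + si) + s)) / 12); last by field.
  by rewrite divr_ge0// mulr_ge0 ?sqr_ge0//; lra.
have e2 : - (k * si ^+ 2) <= 2 * ta * ((c + g) * (b + be) - c * b).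
  have := ger_Nprod hta hcb; lra.
have e3 : - ((1 + k ^+ 2) / (4 * s0) * si ^+ 2) <= 2 * (c * b / s) * (c * be + s * ta).
  have h : `|2 * (c * b / s)| <= s0^-1.
    rewrite !normrM normfV (gtr0_norm c_gt0) (gtr0_norm s_gt0) gtr0_norm//.
    have hc : c * `|b| <= 1 / 2.
      have : c * `|b| <= 1 * (1 / 2) by rewrite ler_pM// ltW.
      lra.
    have : c * `|b| * s^-1 <= 1 / 2 * s^-1 by rewrite ler_wpM2r// invr_ge0 ltW.
    lra.
  have hep2 : (g ^+ 2 + si ^+ 2) / 4 <= (1 + k ^+ 2) / 4 * si ^+ 2.
    have : `|g| ^+ 2 <= (k * si) ^+ 2.
      by rewrite lerXn2r// nnegrE ?normr_ge0// mulr_ge0// ltW.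
    rewrite real_normK ?num_real// exprMn; lra.
  have := ger_Nprod h (le_trans hep hep2).
  rewrite (_ : (1 + k ^+ 2) / (4 * s0) * si ^+ 2 =
    s0^-1 * ((1 + k ^+ 2) / 4 * si ^+ 2))//.
  by field; rewrite gt_eqF.
have e4 : - (k / (2 * s0 ^+ 2) * si ^+ 2) <=
    - si / (s * (s + si)) * ((b + be) ^+ 2 - b ^+ 2).
  have h : `|- si / (s * (s + si))| <= si / s0 ^+ 2.
    rewrite mulNr normrN normrM normfV (gtr0_norm hsi) gtr0_norm ?mulr_gt0//.
    rewrite ler_wpM2l ?(ltW hsi)// lef_pV2 ?posrE ?mulr_gt0 ?exprn_gt0//.
    rewrite expr2; apply: ler_pM; lra.
  have := ger_Nprod h hbb.
  rewrite (_ : si / s0 ^+ 2 * (k / 2 * si) = k / (2 * s0 ^+ 2) * si ^+ 2)//.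
  by field; rewrite gt_eqF.
have e5 : 0 <= c ^+ 2 / s * be ^+ 2 by rewrite mulr_ge0 ?sqr_ge0// divr_ge0 ?sqr_ge0// ltW.
have e6 : 0 <= si * b ^+ 2 * (si / (s ^+ 2 * (s + si))).
  apply: mulr_ge0; first by rewrite mulr_ge0 ?sqr_ge0// ltW.
  by rewrite divr_ge0 ?mulr_ge0 ?sqr_ge0// ltW.
rewrite -subr_ge0.
have := addr_ge0 e5 e6.
rewrite -subr_ge0 in e1; rewrite -subr_ge0 in e2; rewrite -subr_ge0 in e3.
rewrite -subr_ge0 in e4.
move/(addr_ge0 (addr_ge0 (addr_ge0 e1 e2) (addr_ge0 e3 e4))); congr (0 <= _).
rewrite mulrBr [2 * (c * b / s) * _](_ : _ = 2 * (c ^+ 2 / s) * b * be + 2 * c * b * ta).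
  by rewrite c'E cE; field; rewrite !gt_eqF.
by field; rewrite gt_eqF.
Qed.

(* [(a, t)] and [(c - a, t - s)] are the points of the right half-profile with outer
   normals [(c, s)] and [(c, - s)]; the four inequalities are the support conditions
   for the parameters [(c, s)] and [(c', s')]. *)
Lemma profile_step (s0 c0 c s a t c' s' a' t' K : R) :
  0 < s0 -> 0 < c0 -> s0 <= s -> s < s' -> c0 <= c' ->
  0 <= c -> c ^+ 2 + s ^+ 2 = 1 -> c' ^+ 2 + s' ^+ 2 = 1 ->
  0 <= a <= c -> 0 <= a' <= c' ->
  c * a' + s * t' <= c * a + s * t ->
  c' * a + s' * t <= c' * a' + s' * t' ->
  c * (c' - a') + s * (s' - t') <= c * (c - a) + s * (s - t) ->
  c' * (c - a) + s' * (s - t) <= c' * (c' - a') + s' * (s' - t') ->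
  K = 1 / 4 + c0^-1 + (1 + c0^-1 ^+ 2) / (4 * s0) + c0^-1 / (2 * s0 ^+ 2) ->
  [/\ a' <= a, t <= t', c' - a' <= c - a, s - t <= s' - t' &
  - ((s' - s) * (a - c / 2) ^+ 2 / s ^+ 2) - K * (s' - s) ^+ 2 <=
  (t' - t) * a' ^+ 2 + (s' - s - (t' - t)) * (c' - a') ^+ 2
  + ((1 - s' ^+ 2) / s' * (a' - c' / 2) ^+ 2 - (1 - s ^+ 2) / s * (a - c / 2) ^+ 2)
  - (s' - s) / 4 + (s' ^+ 3 - s ^+ 3) / 12].
Proof.
move=> s00 c00 s0s ss' c0c' c_ge0 cs cs' /andP[a0 ac] /andP[a0' ac'] H1 H2 H3 H4 KE.
have s_gt0 : 0 < s by lra.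
have s'_gt0 : 0 < s' by lra.
have c'_gt0 : 0 < c' by lra.
have sE : (s' - s) * (s' + s) = (c - c') * (c + c').
  by rewrite -!subr_sqr; lra.
have c'c : c' < c.
  have : 0 < (c - c') * (c + c') by rewrite -sE mulr_gt0//; lra.
  by rewrite pmulr_lgt0 ?subr_gt0//; lra.
have c_gt0 : 0 < c by lra.
have c1 : c <= 1 by rewrite -(@expr_le1 _ 2)//; have := sqr_ge0 s; lra.
have s1 : s' <= 1.
  by rewrite -(@expr_le1 _ 2) ?(ltW s'_gt0)//; have := sqr_ge0 c'; lra.
have cross : 0 < c * s' - c' * s.
  rewrite subr_gt0; apply: (@lt_trans _ _ (c * s)); first by rewrite ltr_pM2r.
  by rewrite ltr_pM2l.
(* Cramer's rule: combining the two inequalities with nonnegative coefficients eliminates one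
   coordinate and leaves the determinant [cross] as factor. *)
have mono x y x' y' : c * x' + s * y' <= c * x + s * y ->
    c' * x + s' * y <= c' * x' + s' * y' -> x' <= x /\ y <= y'.
  move=> h1 h2; split.
    rewrite -subr_ge0 -(pmulr_rge0 _ cross).
    rewrite (_ : (c * s' - c' * s) * (x - x') = s' * ((c * x + s * y) - (c * x' + s * y'))
      + s * ((c' * x' + s' * y') - (c' * x + s' * y))); last by ring.
    by rewrite addr_ge0// mulr_ge0 ?subr_ge0// ltW.
  rewrite -subr_ge0 -(pmulr_rge0 _ cross).
  rewrite (_ : (c * s' - c' * s) * (y' - y) = c' * ((c * x + s * y) - (c * x' + s * y'))
    + c * ((c' * x' + s' * y') - (c' * x + s' * y))); last by ring.
  by rewrite addr_ge0// mulr_ge0 ?subr_ge0// ltW.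
have [a'a tt'] := mono _ _ _ _ H1 H2.
have [q'q uu'] := mono _ _ _ _ H3 H4.
split=> //; pose k := c0^-1.
have k0 : 0 < k by rewrite invr_gt0.
have hsi : 0 < s' - s by rewrite subr_gt0.
have kc0 : k * c0 = 1 by rewrite mulVf// gt_eqF.
have hgn : `|c' - c| = c - c' by rewrite ltr0_norm ?subr_lt0// opprB.
have hg : `|c' - c| <= k * (s' - s).
  rewrite hgn -(ler_pM2r c00) mulrAC kc0 mul1r.
  have : (c - c') * (2 * c0) <= (c - c') * (c + c') by rewrite ler_pM2l; lra.
  have : (s' - s) * (s' + s) <= (s' - s) * 2 by rewrite ler_pM2l; lra.
  lra.
have [be beE] : exists be, be = (a' - c' / 2) - (a - c / 2) by eexists.
have [ta taE] : exists ta, ta = t' - t - (s' - s) / 2 by eexists.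
have := @energy_step s0 k s c (a - c / 2) (s' - s) (c' - c) be ta.
have bE : a - c / 2 + be = a' - c' / 2 by rewrite beE; ring.
rewrite bE !(addrC _ (_ - s)) !(addrC _ (_ - c)) !subrK => /(_ K s00 (ltW k0) s0s hsi s1 c_gt0 c1).
have -> : (t' - t) * a' ^+ 2 + (s' - s - (t' - t)) * (c' - a') ^+ 2 =
  (s' - s) * (c' ^+ 2 / 4 + (a' - c' / 2) ^+ 2) + 2 * ta * (c' * (a' - c' / 2)).
  by rewrite taE; field.
apply => //.
- lra.
- lra.
- have : `|be| <= (c - c') / 2 by rewrite beE ler_norml; apply/andP; split; lra.
  lra.
- rewrite taE ler_norml; apply/andP; split; lra.
- rewrite ler_norml; apply/andP; split; lra.
- rewrite ler_norml; apply/andP; split; lra.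
(* Both normals are unit vectors, so the quadratic expression is linear in the increments. The
   support conditions at [(c, s)] for the two points bound [c * be + s * ta] by it from either side:
   this is the discrete form of [c db + s dtau = 0]. *)
- have -> : ((c' - c) ^+ 2 + (s' - s) ^+ 2) / 4 = - (c * (c' - c) + s * (s' - s)) / 2.
    rewrite !sqrrB; lra.
  rewrite beE taE ler_norml; apply/andP; split; lra.
Qed.

End core.

Section core.
Variable R : realType.

Lemma sqrt_subr1_sqr (s : R) : 0 <= s -> s <= 1 -> Num.sqrt (1 - s ^+ 2) ^+ 2 = 1 - s ^+ 2.
Proof. by move=> s0 s1; rewrite sqr_sqrtr// subr_ge0 expr_le1. Qed.

(* [Phi s] stands for the volume, up to the area of the unit disc, of the part of the
   body lying between the heights of the two boundary points with normals [(c, s)]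
   and [(c, - s)]. Formally, with [b = a - c / 2],
     dPhi = c^2/4 ds - b^2/s^2 ds - d(c^2/s * b^2),
   where [|b|] is at most [c / 2] and [(1 - c) / 2]. *)
Lemma profile_bound (a t Phi : R -> R) (c := fun s : R => Num.sqrt (1 - s ^+ 2)) :
  (forall s, 0 < s -> s < 1 ->
     [/\ 0 <= a s <= c s, a s <= 1 / 2, c s - a s <= 1 / 2 & 0 <= Phi s]) ->
  (forall s s', 0 < s -> s < 1 -> 0 < s' -> s' < 1 ->
     c s * a s' + s * t s' <= c s * a s + s * t s /\
     c s * (c s' - a s') + s * (s' - t s') <= c s * (c s - a s) + s * (s - t s)) ->
  (forall s s', 0 < s -> s < s' -> s' < 1 -> a s' <= a s -> t s <= t s' ->
     c s' - a s' <= c s - a s -> s - t s <= s' - t s' ->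
     Phi s + ((t s' - t s) * a s' ^+ 2 + (s' - s - (t s' - t s)) * (c s' - a s') ^+ 2)
       <= Phi s') ->
  353 / 2500 <= Phi (99 / 100).
Proof.
move=> Ha Hs HPhi.
(* [sm] approximates sqrt 3 / 2, where [c = 1 / 2] and the bounds [c / 2] and [(1 - c) / 2] on [|b|]
   cross. The cutoffs [s0] and [s1] keep [1 / s] and [1 / c] bounded; the size of [K] does not
   affect the result, since the quadratic errors vanish under refinement. *)
pose s0 : R := 1 / 1000; pose sm : R := 866 / 1000; pose s1 : R := 99 / 100.
pose K : R := 1 / 4 + (1 / 10)^-1 + (1 + (1 / 10)^-1 ^+ 2) / (4 * s0)
  + (1 / 10)^-1 / (2 * s0 ^+ 2).
(* Formally [dF = - b^2 / s^2 ds]: the integral of [c^2 / 4] and the boundary term have been moved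
   to the left. *)
pose F (s : R) := Phi s + (1 - s ^+ 2) / s * (a s - c s / 2) ^+ 2 - s / 4 + s ^+ 3 / 12.
have cE s : 0 < s -> s < 1 -> c s ^+ 2 = 1 - s ^+ 2.
  by move=> h h'; rewrite sqrt_subr1_sqr// ltW.
have c0 s : 0 <= c s by exact: sqrtr_ge0.
have Fstep s s' : s0 <= s -> s < s' -> s' <= s1 ->
    F s - (s' - s) * (a s - c s / 2) ^+ 2 / s ^+ 2 - K * (s' - s) ^+ 2 <= F s'.
  move=> s0s ss' s's1.
  have s_gt0 : 0 < s by rewrite /s0 in s0s; lra.
  have s'_gt0 : 0 < s' by lra.
  have s'1 : s' < 1 by rewrite /s1 in s's1; lra.
  have ss1 : s < 1 by lra.
  have [as_ _ _ _] := Ha s s_gt0 ss1; have [as'_ _ _ _] := Ha s' s'_gt0 s'1.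
  have [h1 h3] := Hs s s' s_gt0 ss1 s'_gt0 s'1.
  have [h2 h4] := Hs s' s s'_gt0 s'1 s_gt0 ss1.
  have c0c' : 1 / 10 <= c s'.
    rewrite -(@ler_pXn2r _ 2)// ?nnegrE ?c0 ?divr_ge0// cE//.
    have : s' ^+ 2 <= s1 ^+ 2 by rewrite ler_pXn2r// ?nnegrE ltW// (lt_le_trans s'_gt0).
    by rewrite /s1; lra.
  have s00 : 0 < s0 by rewrite /s0; lra.
  have i10 : (0 : R) < 1 / 10 by lra.
  have css : c s ^+ 2 + s ^+ 2 = 1 by rewrite cE// subrK.
  have css' : c s' ^+ 2 + s' ^+ 2 = 1 by rewrite cE// subrK.
  have [e1 e2 e3 e4 e5] := profile_step s00 i10 s0s ss' c0c' (c0 s) css css'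
    as_ as'_ h1 h2 h3 h4 (erefl K).
  have := HPhi s s' s_gt0 ss' s'1 e1 e2 e3 e4.
  rewrite /F; lra.
have b2 s : 0 < s -> s < 1 -> (a s - c s / 2) ^+ 2 <= (1 - s ^+ 2) / 4.
  move=> h h'; have [/andP[h1 h2] _ _ _] := Ha s h h'; rewrite -cE//.
  have : 0 <= a s * (c s - a s) by rewrite mulr_ge0 ?subr_ge0.
  rewrite sqrrB; lra.
(* A polynomial majorant of [(1 - c)^2 / 4]: [1 / 16] is its leading coefficient at [s = 0], and
   [7 / 108] gives equality at [c = 1 / 2]. Divided by [s^2], it has the antiderivative
   [s^3 / 48 + 7 / 540 * s^5] of [G1]. *)
have b1 s : 0 < s -> s <= sm -> (a s - c s / 2) ^+ 2 <= s ^+ 4 / 16 + 7 / 108 * s ^+ 6.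
  move=> h hm; have h' : s < 1 by rewrite /sm in hm; lra.
  have [/andP[h1 h2] h3 h4 _] := Ha s h h'.
  have ch : 1 / 2 <= c s.
    rewrite -(@ler_pXn2r _ 2)// ?nnegrE ?c0 ?divr_ge0// cE//.
    have : s ^+ 2 <= sm ^+ 2 by rewrite ler_pXn2r// ?nnegrE ltW// (lt_le_trans h).
    by rewrite /sm; lra.
  have c1 : c s <= 1 by rewrite -(@expr_le1 _ 2)// cE//; have := sqr_ge0 s; lra.
  have hb : (a s - c s / 2) ^+ 2 <= (1 - c s) ^+ 2 / 4.
    rewrite (_ : (1 - c s) ^+ 2 / 4 = ((1 - c s) / 2) ^+ 2); last by field.
    rewrite -real_normK ?num_real// lerXn2r// ?nnegrE ?normr_ge0 ?divr_ge0 ?subr_ge0//.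
    rewrite ler_norml; apply/andP; split; lra.
  apply: le_trans hb _.
  have -> : s ^+ 4 / 16 + 7 / 108 * s ^+ 6 = (s ^+ 2) ^+ 2 / 16 + 7 / 108 * (s ^+ 2) ^+ 3.
    by rewrite -!exprM.
  have -> : s ^+ 2 = 1 - c s ^+ 2 by rewrite cE//; ring.
  have [y yE] : exists y, c s = 1 / 2 + y by exists (c s - 1 / 2); ring.
  have y0 : 0 <= y by lra.
  rewrite yE in c1 *; rewrite -subr_ge0.
  rewrite (_ : (1 - (1 / 2 + y) ^+ 2) ^+ 2 / 16 + 7 / 108 * (1 - (1 / 2 + y) ^+ 2) ^+ 3
    - (1 - (1 / 2 + y)) ^+ 2 / 4 = (1 - (1 / 2 + y)) ^+ 3 * y
    * (7 / 108 * (27 / 4 + 9 / 2 * y + y ^+ 2) - 1 / 16)); last by field.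
  rewrite !mulr_ge0 ?exprn_ge0 ?subr_ge0//; have := sqr_ge0 y; lra.
have K0 : 0 <= K by rewrite /K /s0; lra.
have G1 : F s0 + (s0 ^+ 3 / 48 + 7 / 540 * s0 ^+ 5) <= F sm + (sm ^+ 3 / 48 + 7 / 540 * sm ^+ 5).
  apply: (@sub_quadratic_error_le R (fun s => F s + (s ^+ 3 / 48 + 7 / 540 * s ^+ 5)) s0 sm K).
    by rewrite /s0 /sm; lra.
  move=> s s' h1 h2 h3.
  have s_gt0 : 0 < s by rewrite /s0 in h1; lra.
  have s's1 : s' <= s1 by rewrite /sm in h3; rewrite /s1; lra.
  have := Fstep s s' h1 h2 s's1.
  have hb : (s' - s) * (a s - c s / 2) ^+ 2 / s ^+ 2 <=
      (s' - s) * (s ^+ 2 / 16 + 7 / 108 * s ^+ 4).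
    rewrite ler_pdivrMr ?exprn_gt0//.
    rewrite (_ : (s' - s) * (s ^+ 2 / 16 + 7 / 108 * s ^+ 4) * s ^+ 2 =
      (s' - s) * (s ^+ 4 / 16 + 7 / 108 * s ^+ 6)); last by field.
    by rewrite ler_pM2l ?subr_gt0// b1//; lra.
  have h3' : (s' - s) * s ^+ 2 * 3 <= s' ^+ 3 - s ^+ 3.
    rewrite -subr_ge0 (_ : s' ^+ 3 - s ^+ 3 - (s' - s) * s ^+ 2 * 3 =
      (s' - s) ^+ 2 * (s' + 2 * s)); last by ring.
    by rewrite mulr_ge0 ?sqr_ge0//; lra.
  have h5' : (s' - s) * s ^+ 4 * 5 <= s' ^+ 5 - s ^+ 5.
    rewrite -subr_ge0 (_ : s' ^+ 5 - s ^+ 5 - (s' - s) * s ^+ 4 * 5 =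
      (s' - s) ^+ 2 * (s' ^+ 3 + 2 * s' ^+ 2 * s + 3 * s' * s ^+ 2 + 4 * s ^+ 3)); last by ring.
    have s'_gt0 : 0 < s' by lra.
    by rewrite mulr_ge0 ?sqr_ge0// !addr_ge0// ?mulr_ge0 ?exprn_ge0 ?(ltW s_gt0) ?(ltW s'_gt0).
  lra.
(* On this range [b^2 / s^2 <= (1 / s^2 - 1) / 4], with antiderivative [- (1 / s + s) / 4]. The
   extra summand is the second-order error of [1 / s]. *)
pose K2 := K + (s0 ^+ 3)^-1 / 4.
have G2 : F sm - (sm^-1 + sm) / 4 <= F s1 - (s1^-1 + s1) / 4.
  apply: (@sub_quadratic_error_le R (fun s => F s - (s^-1 + s) / 4) sm s1 K2).
    by rewrite /s1 /sm; lra.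
  move=> s s' h1 h2 h3.
  have s0s : s0 <= s by rewrite /sm in h1; rewrite /s0; lra.
  have s_gt0 : 0 < s by rewrite /s0 in s0s; lra.
  have s'_gt0 : 0 < s' by lra.
  have s1' : s < 1 by rewrite /s1 in h3; lra.
  have := Fstep s s' s0s h2 h3.
  have hb : (s' - s) * (a s - c s / 2) ^+ 2 / s ^+ 2 <= (s' - s) * ((s ^+ 2)^-1 - 1) / 4.
    rewrite ler_pdivrMr ?exprn_gt0//.
    rewrite (_ : (s' - s) * ((s ^+ 2)^-1 - 1) / 4 * s ^+ 2 = (s' - s) * ((1 - s ^+ 2) / 4)).
      by rewrite ler_pM2l ?subr_gt0// b2.
    by field; rewrite gt_eqF.
  have hi : s'^-1 - s^-1 = - ((s' - s) / s ^+ 2) + (s' - s) ^+ 2 * (s ^+ 2 * s')^-1.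
    by field; rewrite !gt_eqF.
  have : (s' - s) ^+ 2 * (s ^+ 2 * s')^-1 <= (s' - s) ^+ 2 * (s0 ^+ 3)^-1.
    have s00 : 0 < s0 by rewrite /s0; lra.
    apply: ler_wpM2l; first exact: sqr_ge0.
    have p0 : 0 < s0 ^+ 3 by exact: exprn_gt0.
    have p1 : 0 < s ^+ 2 * s' by rewrite mulr_gt0// exprn_gt0.
    rewrite (lef_pV2 p1 p0).
    rewrite exprSr; apply: ler_pM; rewrite ?exprn_ge0 ?(ltW s00)//; last by lra.
    by rewrite lerXn2r ?nnegrE ?(ltW s00) ?(ltW s_gt0).
  rewrite /K2.
  lra.
have [_ _ _ P0] : [/\ 0 <= a s0 <= c s0, a s0 <= 1 / 2, c s0 - a s0 <= 1 / 2 & 0 <= Phi s0].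
  by apply: Ha; rewrite /s0; lra.
have D1 : (1 - s1 ^+ 2) / s1 * (a s1 - c s1 / 2) ^+ 2 <= (1 - s1 ^+ 2) / s1 * ((1 - s1 ^+ 2) / 4).
  by rewrite ler_wpM2l ?b2//; rewrite /s1; lra.
have D0 : 0 <= (1 - s0 ^+ 2) / s0 * (a s0 - c s0 / 2) ^+ 2.
  by rewrite mulr_ge0 ?sqr_ge0//; rewrite /s0; lra.
have -> : Phi (99 / 100) = Phi s1 by [].
move: G1 G2; rewrite /F.
move: D0 D1 P0.
move: ((1 - s0 ^+ 2) / s0 * _) => D0; move: ((1 - s1 ^+ 2) / s1 * (a s1 - _) ^+ 2) => D1.
move: (Phi s0) (Phi s1) (Phi sm) ((1 - sm ^+ 2) / sm * _) => p0 p1 pm Dm.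
rewrite /s0 /sm /s1; lra.
Qed.

End core.

(** * Volume bounds by boxes *)

Delimit Scope Z_scope with ZZ.

Section numerics.
Variable R : realType.

Definition ZtoR (z : Z) : R := (int_of_Z z)%:~R.

Lemma ler_ZtoR (m n : Z) : (m <= n)%ZZ -> ZtoR m <= ZtoR n.
Proof. by move=> mn; rewrite /ZtoR ler_int; lia. Qed.

Lemma ZtoRD (m n : Z) : ZtoR (m + n)%ZZ = ZtoR m + ZtoR n.
Proof. by rewrite /ZtoR -intrD; congr (_%:~R); lia. Qed.

Lemma ZtoRM (m n : Z) : ZtoR (m * n)%ZZ = ZtoR m * ZtoR n.
Proof. by rewrite /ZtoR -intrM; congr (_%:~R); lia. Qed.

Lemma ZtoRB (m n : Z) : ZtoR (m - n)%ZZ = ZtoR m - ZtoR n.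
Proof. by rewrite /ZtoR -intrB; congr (_%:~R); lia. Qed.

Lemma ZtoR_nat (n : nat) : ZtoR (Z.of_nat n) = n%:R.
Proof. by rewrite /ZtoR -[n%:R]/(n%:~R); congr (_%:~R); lia. Qed.

Lemma ZtoR_sqrt_up (x : Z) : ZtoR x <= ZtoR (Z.sqrt_up x) ^+ 2.
Proof.
rewrite expr2 -ZtoRM; apply: ler_ZtoR.
case: (Z.leb_spec x 0) => [x0|x0]; first by rewrite Z.sqrt_up_eqn0 //; lia.
by have [] := Z.sqrt_up_spec x x0; lia.
Qed.

Lemma ZtoR_sqrt (x : Z) : (0 <= x)%ZZ -> ZtoR (Z.sqrt x) ^+ 2 <= ZtoR x.
Proof.
move=> x0; rewrite expr2 -ZtoRM; apply: ler_ZtoR.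
by have [] := Z.sqrt_spec x x0; lia.
Qed.

Fixpoint Zsum (n : nat) (F : nat -> Z) : Z :=
  if n is m.+1 then (Zsum m F + F m)%ZZ else 0%ZZ.

Lemma ZtoR_sum (n : nat) (F : nat -> Z) :
  ZtoR (Zsum n F) = \sum_(i < n) ZtoR (F i).
Proof.
elim: n => [|n IH]; first by rewrite big_ord0.
by rewrite big_ord_recr /= ZtoRD IH.
Qed.

(* For [w = 1], the points of the set of [lebesgue3_tetra_le] with [i / 80 <= |x|] and
   [j / 80 <= |y|] satisfy [(1600 * (z - h))^2 <= tetra_radicand i j], and symmetrically
   for [z + h]. Hence [tetra_cell i j / 1600] bounds the height of the set above such
   points, as [1131 <= 1600 * 2 h]; the value [-2000] marks an empty cell. *)
Definition tetra_radicand (i j : nat) : Z :=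
  let i := Z.of_nat i in let j := Z.of_nat j in
  (100 * (240 * 80 - 4 * i * i - 4 * j * j - 320 * i))%ZZ.

Definition tetra_root (i j : nat) : Z :=
  if (tetra_radicand i j <? 0)%ZZ then (-2000)%ZZ else Z.sqrt_up (tetra_radicand i j).

Definition tetra_cell (i j : nat) : Z :=
  Z.max 0 (tetra_root i j + tetra_root j i - 1131).

Lemma tetra_cell_sum :
  (Zsum 41 (fun i => Zsum 41 (tetra_cell i)) <= 1130 * 1000)%ZZ.
Proof. by vm_compute. Qed.

(* [disc_cell i / 400] is at most the half-height of the unit disc at the abscissa
   [(i + 1) / 400]. *)
Definition disc_cell (i : nat) : Z :=
  let i := Z.of_nat i in Z.sqrt (400 * 400 - (i + 1) * (i + 1)).

Lemma disc_cell_sum : (313 * 400 <= Zsum 400 disc_cell)%ZZ.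
Proof. by vm_compute. Qed.

End numerics.

Section boxes.
Variable R : realType.
Let mR := measurableTypeR R.
Local Notation mu := (@lebesgue_measure R).

(** Half-open, so that consecutive columns are disjoint and their areas add up to a lower bound; the
    closed variant [cabs] serves for covers. *)
Definition oabs (a b : R) : set mR := [set x | a < `|x : R| <= b].
Definition cabs (a b : R) : set mR := [set x | a <= `|x : R| <= b].

Lemma cabsE a b : 0 <= a -> cabs a b = `[a, b]%classic `|` `[- b, - a]%classic.
Proof.
move=> a0; apply/seteqP; split => x /=; rewrite /cabs /= !in_itv /=.
  by have [x0|x0] := ger0P x => /andP[h1 h2]; [left|right]; lra.
case=> /andP[h1 h2]; last by rewrite ler0_norm; lra.
by rewrite ger0_norm; lra.
Qed.

Lemma oabsE a b : 0 <= a -> oabs a b = `]a, b]%classic `|` `[- b, - a[%classic.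
Proof.
move=> a0; apply/seteqP; split => x /=; rewrite /oabs /= !in_itv /=.
  by have [x0|x0] := ger0P x => /andP[h1 h2]; [left|right]; lra.
case=> /andP[h1 h2]; last by rewrite ler0_norm; lra.
by rewrite ger0_norm; lra.
Qed.

Lemma measurable_cabs a b : 0 <= a -> measurable (cabs a b).
Proof. by move=> a0; rewrite cabsE//; apply: measurableU; exact: measurable_itv. Qed.

Lemma measurable_oabs a b : 0 <= a -> measurable (oabs a b).
Proof. by move=> a0; rewrite oabsE//; apply: measurableU; exact: measurable_itv. Qed.

Lemma lebesgue_cabs_le a b : 0 <= a -> a <= b -> (mu (cabs a b) <= (2 * (b - a))%:E)%E.
Proof.
move=> a0 ab; rewrite cabsE//.
have m1 : measurable (`[a, b]%classic : set mR) by exact: measurable_itv.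
have m2 : measurable (`[- b, - a]%classic : set mR) by exact: measurable_itv.
apply: le_trans (measureU2 (@lebesgue_measure R) m1 m2) _.
rewrite /= !lebesgue_measure_itv /= !lte_fin.
by case: ifP => h1; case: ifP => h2; rewrite -?EFinD lee_fin ?adde0; lra.
Qed.

Lemma lebesgue_oabs a b : 0 <= a -> a <= b -> mu (oabs a b) = (2 * (b - a))%:E.
Proof.
move=> a0 ab; rewrite oabsE// measureU; last first.
- rewrite -subset0 => x [] /=; rewrite !in_itv /= => /andP[? ?] /andP[? ?]; lra.
- exact: measurable_itv.
- exact: measurable_itv.
rewrite /= !lebesgue_measure_itv /= !lte_fin.
have [<-|aNb] := eqVneq a b; first by rewrite !ltxx adde0 subrr mulr0.
have alb : a < b by rewrite lt_neqAle aNb.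
by rewrite ltrN2 alb -!EFinB -EFinD; congr EFin; ring.
Qed.

Lemma lebesgue_itvcc a b : mu `[a, b]%classic = (Num.max 0 (b - a))%:E.
Proof.
rewrite lebesgue_measure_itv /= lte_fin; case: ltP => ab.
  by rewrite -EFinB max_r// subr_ge0 ltW.
by rewrite max_l// subr_le0.
Qed.

Lemma lebesgue2_box (X Y : set mR) : measurable X -> measurable Y ->
  lebesgue2 (X `*` Y) = (mu X * mu Y)%E.
Proof. exact: product_measure1E. Qed.

Lemma lebesgue3_box (X : set (mR * mR)) (Y : set mR) : measurable X -> measurable Y ->
  lebesgue3 (X `*` Y) = (lebesgue2 X * mu Y)%E.
Proof. exact: product_measure1E. Qed.

Definition disc (r : R) : set (mR * mR) := [set p | p.1 ^+ 2 + p.2 ^+ 2 <= r ^+ 2].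

Lemma measurable_disc r : measurable (disc r).
Proof.
rewrite (_ : disc r = (fun p : mR * mR => p.1 ^+ 2 + p.2 ^+ 2 : mR) @^-1` `]-oo, r ^+ 2]%classic).
  rewrite -[_ @^-1` _]setTI; apply: (_ : measurable_fun setT _) => //.
  apply: measurable_funD; apply: measurable_funX.
    exact: measurable_fst.
  exact: measurable_snd.
by apply/seteqP; split => p; rewrite /disc /= in_itv.
Qed.

Lemma lebesgue2_disc_ge (r : R) : 0 <= r -> ((313 / 100 * r ^+ 2)%:E <= lebesgue2 (disc r))%E.
Proof.
move=> r0; pose d := r / 400.
have d0 : 0 <= d by exact: divr_ge0 r0 (ler0n _ _).
pose k (i : nat) := ZtoR R (disc_cell i).
have k0 i : 0 <= k i.
  by rewrite /k -[0]/(ZtoR R Z0); apply: ler_ZtoR; apply: Z.sqrt_nonneg.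
(* Two columns symmetric about the second axis, of total area [2 d * 2 k d]. The half-height is
   taken at the outer abscissa, which keeps them inside the disc. *)
pose F (i : nat) : set (mR * mR) :=
  oabs (i%:R * d) (i.+1%:R * d) `*` `[- (k i * d), k i * d]%classic.
have id0 (i : nat) : 0 <= i%:R * d by rewrite mulr_ge0.
have mF i : measurable (F i).
  by apply: measurableX; [exact: measurable_oabs|exact: measurable_itv].
have FE i : lebesgue2 (F i) = (4 * d ^+ 2 * k i)%:E.
  have h1 : i%:R * d <= i.+1%:R * d by rewrite ler_wpM2r// ler_nat.
  rewrite (lebesgue2_box (measurable_oabs _ (id0 i)) (measurable_itv _)).
  rewrite (lebesgue_oabs (id0 i) h1).
  rewrite lebesgue_itvcc max_r -?EFinM.
    by rewrite -natr1; congr EFin; ring.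
  have := mulr_ge0 (k0 i) d0; lra.
have tF : trivIset `I_400 F.
  apply/trivIsetP => i j _ _ ij; rewrite -subset0 => -[x y] [[/= xi _] [xj _]].
  move: xi xj; rewrite /oabs /= => /andP[i1 i2] /andP[j1 j2].
  move: ij; rewrite neq_ltn => /orP[] lij.
  - have : i.+1%:R * d <= j%:R * d by rewrite ler_wpM2r// ler_nat.
    by rewrite leNgt (lt_le_trans j1).
  - have : j.+1%:R * d <= i%:R * d by rewrite ler_wpM2r// ler_nat.
    by rewrite leNgt (lt_le_trans i1).
have FD : \big[setU/set0]_(i < 400) F i `<=` disc r.
  rewrite -bigcup_mkord => -[x y] [i /= i400] [/=]; rewrite /oabs /disc /= in_itv /=.
  move=> /andP[_ xi]; rewrite -ler_norml => yi.
  have hk : (i.+1%:R : R) ^+ 2 + k i ^+ 2 <= 400 ^+ 2.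
    have hi : Z.le 0 (400 * 400 - (Z.of_nat i + 1) * (Z.of_nat i + 1))%ZZ.
      by nia.
    have := ZtoR_sqrt R hi; rewrite ZtoRB !ZtoRM ZtoRD (ZtoR_nat R 400) (ZtoR_nat R 1) ZtoR_nat.
    by rewrite natr1 -!expr2 -/(disc_cell i) -/(k i); lra.
  have hx : x ^+ 2 <= (i.+1%:R * d) ^+ 2.
    by rewrite -[x ^+ 2]real_normK ?num_real// lerXn2r// nnegrE.
  have hy : y ^+ 2 <= (k i * d) ^+ 2.
    by rewrite -[y ^+ 2]real_normK ?num_real// lerXn2r// nnegrE mulr_ge0.
  apply: (le_trans (lerD hx hy)).
  rewrite (_ : r ^+ 2 = 400 ^+ 2 * d ^+ 2); last by rewrite /d; field.
  rewrite [(i.+1%:R * d) ^+ 2]exprMn [(k i * d) ^+ 2]exprMn -mulrDl.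
  by apply: ler_wpM2r; rewrite ?sqr_ge0.
have mU : measurable (\big[setU/set0]_(i < 400) F i) by exact: bigsetU_measurable.
apply: le_trans (le_measure (@lebesgue2 R) _ _ FD); last 2 first.
- by rewrite inE.
- by rewrite inE; exact: measurable_disc.
rewrite (measure_semi_additive_ord_I (@lebesgue2 R) _ tF)//.
rewrite (eq_bigr (fun i : 'I_400 => (4 * d ^+ 2 * k i)%:E)); last first.
  by move=> i _; exact: FE.
rewrite sumEFin lee_fin -mulr_sumr -(ZtoR_sum R 400 disc_cell).
have := ler_ZtoR R disc_cell_sum; rewrite ZtoRM (ZtoR_nat R 313) (ZtoR_nat R 400) => hZ.
have : 4 * d ^+ 2 * (313 * 400) <= 4 * d ^+ 2 * ZtoR R (Zsum 400 disc_cell).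
  by rewrite ler_wpM2l// mulr_ge0 ?sqr_ge0.
by rewrite (_ : 4 * d ^+ 2 * (313 * 400) = 313 / 100 * r ^+ 2)// /d; field.
Qed.

End boxes.

(** * Upper bound for the volume of the Reuleaux tetrahedron *)

Section tetra.
Variable R : realType.
Let mR := measurableTypeR R.
Local Notation mu := (@lebesgue_measure R).
Variables (w h : R).
Hypotheses (w0 : 0 < w) (h0 : 0 <= h) (hw : 8 * h ^+ 2 = w ^+ 2).

Let d := w / 80.
Let r i j : R := ZtoR R (tetra_root i j) / 1600.

Definition tetra_box (i j : nat) : set (mR * mR * mR) :=
  (cabs (i%:R * d) (i.+1%:R * d) `*` cabs (j%:R * d) (j.+1%:R * d)) `*`
  `[h - w * r i j, - h + w * r j i]%classic.

Lemma measurable_tetra_box i j : measurable (tetra_box i j).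
Proof.
have d0 n : 0 <= n%:R * d by rewrite mulr_ge0 ?divr_ge0 ?(ltW w0).
by apply: measurableX; [apply: measurableX; exact: measurable_cabs|exact: measurable_itv].
Qed.

Lemma lebesgue3_tetra_box i j :
  (lebesgue3 (tetra_box i j) <= (w ^+ 3 / (1600 * 1600) * ZtoR R (tetra_cell i j))%:E)%E.
Proof.
have d0 : 0 <= d by rewrite divr_ge0 ?(ltW w0).
have dn n : 0 <= n%:R * d by rewrite mulr_ge0.
have dS n : n%:R * d <= n.+1%:R * d by rewrite ler_wpM2r// ler_nat.
rewrite lebesgue3_box; last exact: measurable_itv; last first.
  by apply: measurableX; exact: measurable_cabs.
rewrite lebesgue2_box; last exact: measurable_cabs; last exact: measurable_cabs.
rewrite lebesgue_itvcc.
have c n : (mu (cabs (n%:R * d) (n.+1%:R * d)) <= (2 * d)%:E)%E.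
  apply: le_trans (lebesgue_cabs_le (dn n) (dS n)) _.
  by rewrite lee_fin (_ : n.+1%:R * d - n%:R * d = d)// -natr1; ring.
have M0 : 0 <= Num.max 0 (- h + w * r j i - (h - w * r i j)) by rewrite le_max lexx.
apply: le_trans (lee_pmul _ _ (lee_pmul _ _ (c i) (c j)) (lexx _)) _ => //.
  by rewrite mule_ge0.
rewrite -!EFinM lee_fin.
have hk k : 0 <= k -> k ^+ 2 <= 1 / 2 -> w * k <= 2 * h.
  move=> k0 k2; rewrite -(@ler_pXn2r _ 2)// ?nnegrE ?mulr_ge0// ?(ltW w0)//.
  rewrite (_ : (2 * h) ^+ 2 = w ^+ 2 * (1 / 2)); last by rewrite -hw; field.
  by rewrite exprMn ler_wpM2l ?sqr_ge0.
have hh : w * (1131 / 1600) <= 2 * h by apply: hk; lra.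
have z0 : 0 <= ZtoR R (tetra_cell i j).
  by rewrite -[0]/(ZtoR R Z0); apply: ler_ZtoR; exact: Z.le_max_l.
have zc : ZtoR R (tetra_root i j) + ZtoR R (tetra_root j i) - 1131 <= ZtoR R (tetra_cell i j).
  rewrite -[1131](ZtoR_nat R 1131) -ZtoRD -ZtoRB; apply: ler_ZtoR; exact: Z.le_max_r.
have mx : Num.max 0 (- h + w * r j i - (h - w * r i j)) <= w / 1600 * ZtoR R (tetra_cell i j).
  have k0 : 0 <= w / 1600 by rewrite divr_ge0 ?ler0n ?(ltW w0).
  rewrite ge_max (mulr_ge0 k0 z0) /=.
  have := ler_wpM2l (ltW w0) zc; move: hh; rewrite /r; lra.
apply: le_trans (ler_wpM2l _ mx) _; first by rewrite mulr_ge0// mulr_ge0.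
by rewrite /d le_eqVlt; apply/orP; left; apply/eqP; field.
Qed.

Lemma tetra_root_ge (i j : nat) (x : R) :
  x <= ZtoR R (tetra_radicand i j) -> 0 <= x ->
  0 <= ZtoR R (tetra_root i j) /\ x <= ZtoR R (tetra_root i j) ^+ 2.
Proof.
move=> xr x0; rewrite /tetra_root; case: Z.ltb_spec => [neg|_].
  suff : ZtoR R (tetra_radicand i j) <= -1 by lra.
  rewrite -[-1]/(ZtoR R (Zneg xH)); apply: ler_ZtoR; lia.
split; last exact: le_trans xr (ZtoR_sqrt_up _ _).
by rewrite -[0]/(ZtoR R Z0); apply: ler_ZtoR; exact: Z.sqrt_up_nonneg.
Qed.

Lemma ZtoR_radicand (i j : nat) : ZtoR R (tetra_radicand i j) =
  100 * (240 * 80 - 4 * i%:R ^+ 2 - 4 * j%:R ^+ 2 - 320 * i%:R).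
Proof.
rewrite /tetra_radicand ZtoRM !ZtoRB !ZtoRM !ZtoR_nat.
rewrite (ZtoR_nat R 100) (ZtoR_nat R 4) (ZtoR_nat R 320) (ZtoR_nat R 240).
by rewrite (ZtoR_nat R 80) !expr2 !mulrA.
Qed.

(* The Reuleaux tetrahedron of width [w] in the position where two opposite edges
   are parallel to the first two axes and lie at heights [h] and [- h]. *)
Lemma lebesgue3_tetra_le (A : set (mR * mR * mR)) : measurable A ->
  (forall x y z, A (x, y, z) ->
    (z - h) ^+ 2 + x ^+ 2 + y ^+ 2 + w * `|x| <= 3 / 4 * w ^+ 2 /\
    (z + h) ^+ 2 + x ^+ 2 + y ^+ 2 + w * `|y| <= 3 / 4 * w ^+ 2) ->
  (lebesgue3 A <= (1130 / 2560 * w ^+ 3)%:E)%E.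
Proof.
move=> mA HA.
have d0 : 0 < d by rewrite divr_gt0.
have mU i : measurable (\big[setU/set0]_(j < 41) tetra_box i j).
  by apply: bigsetU_measurable => j _; exact: measurable_tetra_box.
have sub : A `<=` \big[setU/set0]_(i < 41) \big[setU/set0]_(j < 41) tetra_box i j.
  move=> [[x y] z] /HA[hx hy].
  have cell (u : R) : `|u| ^+ 2 + w * `|u| <= 3 / 4 * w ^+ 2 ->
      exists2 n : nat, (n < 41)%N & n%:R * d <= `|u| <= n.+1%:R * d.
    move=> hu; have uw : `|u| <= w / 2.
      rewrite leNgt; apply/negP => wu.
      have : (w / 2) ^+ 2 < `|u| ^+ 2 by rewrite ltr_pXn2r// ?nnegrE ?divr_ge0 ?(ltW w0).
      have : w * (w / 2) < w * `|u| by rewrite ltr_pM2l.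
      rewrite exprMn; lra.
    have ud : 0 <= `|u| / d by rewrite divr_ge0 ?(ltW d0).
    (* Since [w / 2 = 40 d], the cell of index 40 is there for the endpoint [|u| = w / 2]. *)
    exists (Num.trunc (`|u| / d)).
      rewrite truncn_lt_nat// ltr_pdivrMr//. apply: (le_lt_trans uw); rewrite /d; have := w0; lra.
    have /andP[t1 t2] := truncn_itv ud.
    by rewrite -ler_pdivlMr// t1 -ler_pdivrMr// ltW.
  have hx' : `|x| ^+ 2 + w * `|x| <= 3 / 4 * w ^+ 2.
    rewrite real_normK ?num_real//; have := sqr_ge0 (z - h); have := sqr_ge0 y; lra.
  have hy' : `|y| ^+ 2 + w * `|y| <= 3 / 4 * w ^+ 2.
    rewrite real_normK ?num_real//; have := sqr_ge0 (z + h); have := sqr_ge0 x; lra.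
  have [i i41 xi] := cell x hx'; have [j j41 yj] := cell y hy'.
  rewrite -(bigcup_mkord 41 (fun i => \big[setU/set0]_(j < 41) tetra_box i j)).
  exists i => //; rewrite -(bigcup_mkord 41 (tetra_box i)); exists j => //.
  split; first by split.
  have zbound (v : R) (n m : nat) (a b : R) :
      v ^+ 2 + a ^+ 2 + b ^+ 2 + w * `|a| <= 3 / 4 * w ^+ 2 ->
      n%:R * d <= `|a| -> m%:R * d <= `|b| -> `|v| <= w * r n m.
    move=> hv na mb.
    have na2 : (n%:R * d) ^+ 2 <= a ^+ 2.
      by rewrite -[a ^+ 2]real_normK ?num_real// lerXn2r// nnegrE mulr_ge0 ?(ltW d0).
    have mb2 : (m%:R * d) ^+ 2 <= b ^+ 2.
      by rewrite -[b ^+ 2]real_normK ?num_real// lerXn2r// nnegrE mulr_ge0 ?(ltW d0).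
    have wa : w * (n%:R * d) <= w * `|a| by rewrite ler_pM2l.
    have hr : (1600 * v / w) ^+ 2 <= ZtoR R (tetra_radicand n m).
      rewrite ZtoR_radicand expr_div_n ler_pdivrMr ?exprn_gt0//.
      have -> : 100 * (240 * 80 - 4 * n%:R ^+ 2 - 4 * m%:R ^+ 2 - 320 * n%:R) * w ^+ 2 =
        1600 ^+ 2 * (3 / 4 * w ^+ 2 - (n%:R * d) ^+ 2 - (m%:R * d) ^+ 2 - w * (n%:R * d)).
        by rewrite /d; field.
      rewrite exprMn ler_wpM2l ?sqr_ge0//; lra.
    have [r0 hr2] := tetra_root_ge hr (sqr_ge0 _).
    rewrite -[_ ^+ 2]real_normK ?num_real// in hr2.
    rewrite ler_pXn2r ?nnegrE// in hr2.
    move: hr2; rewrite normrM normfV (gtr0_norm w0) (ler_pdivrMr _ _ w0) normrM.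
    rewrite (ger0_norm (ler0n _ _)).
    rewrite /r; lra.
  (* The vertices at height [h] bound [z] from below, those at height [- h] bound it from above. *)
  have := zbound _ _ _ _ _ hx (andP xi).1 (andP yj).1; rewrite ler_norml => /andP[z1 _].
  have hy2 : (z + h) ^+ 2 + y ^+ 2 + x ^+ 2 + w * `|y| <= 3 / 4 * w ^+ 2 by lra.
  have := zbound _ _ _ _ _ hy2 (andP yj).1 (andP xi).1; rewrite ler_norml => /andP[_ z2].
  by rewrite /= in_itv /=; apply/andP; split; lra.
apply: le_trans (@content_subadditive _ _ _ (@lebesgue3 R) A
  (fun i => \big[setU/set0]_(j < 41) tetra_box i j) 41 _ mA sub) _ => //.
apply: (@le_trans _ _ (\sum_(i < 41) \sum_(j < 41) lebesgue3 (tetra_box i j))%E).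
  apply: lee_sum => i _; apply: Boole_inequality => j _; exact: measurable_tetra_box.
pose k := w ^+ 3 / (1600 * 1600).
apply: (@le_trans _ _ (\sum_(i < 41) \sum_(j < 41) (k * ZtoR R (tetra_cell i j))%:E)%E).
  by apply: lee_sum => i _; apply: lee_sum => j _; exact: lebesgue3_tetra_box.
rewrite (eq_bigr (fun i : 'I_41 => (k * ZtoR R (Zsum 41 (tetra_cell i)))%:E)); last first.
  by move=> i _; rewrite sumEFin -mulr_sumr ZtoR_sum.
rewrite sumEFin -mulr_sumr -(ZtoR_sum R 41 (fun i => Zsum 41 (tetra_cell i))) lee_fin.
have k0 : 0 <= k.
  apply: divr_ge0; first by rewrite exprn_ge0// ltW.
  by apply: mulr_ge0; exact: ler0n.
apply: le_trans (ler_wpM2l k0 (ler_ZtoR R tetra_cell_sum)) _.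
rewrite ZtoRM (ZtoR_nat R 1130) (ZtoR_nat R 1000).
by rewrite /k le_eqVlt; apply/orP; left; apply/eqP; field.
Qed.

End tetra.

(** * Constant width and complete sets *)

Section dot_product.
Variable R : realType.
Implicit Types (x y u : 'rV[R]_3) (k : R).

Lemma dotpC x y : dotp x y = dotp y x.
Proof. by rewrite !dotpE; ring. Qed.

Lemma dotpDl x y u : dotp (x + y) u = dotp x u + dotp y u.
Proof. by rewrite !dotpE !mxE; ring. Qed.

Lemma dotpNl x u : dotp (- x) u = - dotp x u.
Proof. by rewrite !dotpE !mxE; ring. Qed.

Lemma dotpBl x y u : dotp (x - y) u = dotp x u - dotp y u.
Proof. by rewrite dotpDl dotpNl. Qed.

Lemma dotpZl k x u : dotp (k *: x) u = k * dotp x u.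
Proof. by rewrite !dotpE !mxE; ring. Qed.

Lemma dotpNr x u : dotp u (- x) = - dotp u x.
Proof. by rewrite dotpC dotpNl dotpC. Qed.

Lemma dotpZr k x u : dotp u (k *: x) = k * dotp u x.
Proof. by rewrite dotpC dotpZl dotpC. Qed.

Lemma dotpDr x y u : dotp u (x + y) = dotp u x + dotp u y.
Proof. by rewrite dotpC dotpDl !(dotpC u). Qed.

Lemma dotpBr x y u : dotp u (x - y) = dotp u x - dotp u y.
Proof. by rewrite dotpDr dotpNr. Qed.

Lemma dotp_ge0 x : 0 <= dotp x x.
Proof. by rewrite dotpE -!expr2 !addr_ge0 ?sqr_ge0. Qed.

Lemma dotp_eq0 x : (dotp x x == 0) = (x == 0).
Proof.
apply/eqP/eqP => [|->]; last by rewrite dotpE !mxE; ring.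
rewrite dotpE -!expr2 => /eqP.
rewrite paddr_eq0 ?addr_ge0 ?sqr_ge0// paddr_eq0 ?sqr_ge0// !sqrf_eq0.
move=> /andP[/andP[/eqP h0 /eqP h1] /eqP h2].
by rewrite [x]vecP h0 h1 h2 -[RHS](scale0r (vec 0 0 0)) vecZ !mul0r.
Qed.

Lemma dotp_CS x u : dotp x u ^+ 2 <= dotp x x * dotp u u.
Proof.
rewrite -subr_ge0 !dotpE.
set a := x 0 0; set b := x 0 1; set c := x 0 2%:R.
set d := u 0 0; set e := u 0 1; set f := u 0 2%:R.
rewrite (_ : _ - _ = (a * e - b * d) ^+ 2 + (a * f - c * d) ^+ 2 + (b * f - c * e) ^+ 2).
  by rewrite !addr_ge0 ?sqr_ge0.
by rewrite /a /b /c /d /e /f; ring.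
Qed.

Lemma enorm_eq1 u : enorm u = 1 <-> dotp u u = 1.
Proof.
split=> [h|h]; last by rewrite /enorm h sqrtr1.
by rewrite -[LHS]sqr_sqrtr ?dotp_ge0// -/(enorm u) h expr1n.
Qed.

Lemma enorm_ge0 x : 0 <= enorm x. Proof. exact: sqrtr_ge0. Qed.

Lemma sqr_enorm x : enorm x ^+ 2 = dotp x x.
Proof. by rewrite sqr_sqrtr// dotp_ge0. Qed.

Lemma le_enorm x k : 0 <= k -> (enorm x <= k) = (dotp x x <= k ^+ 2).
Proof. by move=> k0; rewrite -sqr_enorm ler_pXn2r// nnegrE enorm_ge0. Qed.

Lemma dotp_le_enorm x u : dotp u u = 1 -> dotp x u <= enorm x.
Proof.
move=> u1; apply: le_trans (ler_norm _) _.
rewrite -(@ler_pXn2r _ 2)// ?nnegrE ?normr_ge0 ?enorm_ge0//.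
by rewrite real_normK ?num_real// sqr_enorm (le_trans (dotp_CS x u))// u1 mulr1.
Qed.

Lemma enormZ k x : enorm (k *: x) = `|k| * enorm x.
Proof. by rewrite /enorm dotpZl dotpZr mulrA -expr2 sqrtrM ?sqr_ge0// sqrtr_sqr. Qed.

Lemma continuous_dotp u : continuous (fun x => dotp x u).
Proof.
move=> x; rewrite (_ : (fun _ => _) = fun x =>
  (x 0 0 * u 0 0 + x 0 1 * u 0 1) + x 0 2%:R * u 0 2%:R); last first.
  by apply/funext => y; rewrite dotpE.
have c i : (fun y : 'rV[R]_3 => y 0 i * u 0 i) y @[y --> x] --> x 0 i * u 0 i.
  have h := @coord_continuous R 1 3 0 i x.
  have := cvgM h (cvg_cst (u 0 i)); exact.
exact: cvgD (cvgD (c 0) (c 1)) (c 2%:R).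
Qed.

End dot_product.

Section constant_width.
Variable R : realType.
Implicit Types (B : set 'rV[R]_3) (w : R).

Definition diameter_le B w := forall x y, B x -> B y -> dotp (x - y) (x - y) <= w ^+ 2.

(** Together with [diameter_le] this expresses constant width through points alone, without suprema
    or planes, so it carries over to other frames. *)
Definition antipodal B w :=
  forall u : 'rV[R]_3, dotp u u = 1 -> exists2 x, B x & B (x - w *: u).

Lemma unit_vec : dotp (vec 0 0 1) (vec 0 0 1) = 1 :> R.
Proof. by rewrite dotp_vec; ring. Qed.

Lemma width_in_directionE B u (x y : 'rV[R]_3) : dotp u u = 1 ->
  B x -> B y -> (forall z, B z -> dotp z u <= dotp x u) ->
  (forall z, B z -> dotp y u <= dotp z u) ->
  width_in_direction B u = dotp (x - y) u.
Proof.
move=> u1 Bx By hx hy.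
have supE : sup [set dotp z u | z in B] = dotp x u.
  apply/eqP; rewrite eq_le; apply/andP; split.
    by apply: ge_sup; [exists (dotp x u), x|move=> _ [z /hx ? <-]].
  apply: ub_le_sup; last by exists x.
  by exists (dotp x u) => _ [z /hx ? <-].
have supNE : sup [set dotp z (- u) | z in B] = - dotp y u.
  apply/eqP; rewrite eq_le; apply/andP; split.
    apply: ge_sup; first by exists (dotp y (- u)), y.
    by move=> _ [z /hy ? <-]; rewrite dotpNr lerN2.
  apply: ub_le_sup; last by exists y => //; rewrite dotpNr.
  by exists (- dotp y u) => _ [z /hy ? <-]; rewrite dotpNr lerN2.
rewrite /width_in_direction /edistance /support_plane supE supNE.
set E := [set d | _].
have lbE : lbound E (dotp (x - y) u).
  move=> _ [a [b [/= ha hb ->]]].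
  apply: le_trans (dotp_le_enorm _ u1).
  move: hb; rewrite dotpNr => /oppr_inj hb.
  by rewrite !dotpBl ha hb.
have EE : E (dotp (x - y) u).
  (* The distance is attained where the two planes meet the line spanned by [u]; these points need
     not belong to [B]. *)
  exists (dotp x u *: u), (dotp y u *: u); split => /=.
  - by rewrite dotpZl u1 mulr1.
  - by rewrite dotpNr dotpZl u1 mulr1.
  - rewrite -scalerBl enormZ (enorm_eq1 u).2// mulr1 ger0_norm ?dotpBl//.
    by rewrite subr_ge0 hx.
apply/eqP; rewrite eq_le; apply/andP; split.
  by apply: ge_inf => //; exists (dotp (x - y) u).
by apply: lb_le_inf => //; exists (dotp (x - y) u).
Qed.

Lemma compact_support_point B u : compact B -> B !=set0 ->
  exists2 x : 'rV[R]_3, B x & forall z, B z -> dotp z u <= dotp x u.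
Proof.
move=> cB B0; have [|c cB' H] := @EVT_max_rV R 3 (fun x => dotp x u) B B0 cB.
  by apply: continuous_subspaceT; exact: continuous_dotp.
by exists c; [exact: set_mem|move=> z Bz; apply: H; rewrite inE].
Qed.

(** A chord is no longer than the width in its own direction, hence the diameter bound. If [x] and
    [y] are opposite support points, then [|x - y| <= w] and [(x - y) . u = w], so
    [|x - y - w u|^2 <= w^2 - 2 w^2 + w^2 = 0]. *)
Lemma constant_width_antipodal B w : compact B -> B !=set0 -> has_constant_width B w ->
  [/\ 0 <= w, diameter_le B w & antipodal B w].
Proof.
move=> cB B0 cw.
have supp u : dotp u u = 1 -> exists x y, [/\ B x, B y,
    forall z, B z -> dotp z u <= dotp x u, forall z, B z -> dotp y u <= dotp z u
    & dotp (x - y) u = w].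
  move=> u1; have [x Bx hx] := compact_support_point u cB B0.
  have [y By hy] := compact_support_point (- u) cB B0.
  have hy' z : B z -> dotp y u <= dotp z u by move=> /hy; rewrite !dotpNr lerN2.
  exists x, y; split => //.
  by rewrite -(width_in_directionE u1 Bx By hx hy') cw// enorm_eq1.
have w0 : 0 <= w.
  have [x [y [Bx By hx hy <-]]] := supp _ unit_vec.
  by rewrite dotpBl subr_ge0 hx.
have diam : diameter_le B w.
  move=> x y Bx By; rewrite -le_enorm//.
  have [->|xy] := eqVneq x y.
    by rewrite subrr le_enorm// -[0](scale0r (0 : 'rV[R]_3)) dotpZl mul0r sqr_ge0.
  have e0 : enorm (x - y) != 0.
    by rewrite -sqrf_eq0 sqr_enorm dotp_eq0 subr_eq0.
  pose u := (enorm (x - y))^-1 *: (x - y).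
  have u1 : dotp u u = 1.
    by rewrite dotpZl dotpZr -sqr_enorm; field.
  have -> : enorm (x - y) = dotp (x - y) u.
    by rewrite dotpZr -sqr_enorm; field.
  have [a [b [Ba Bb ha hb <-]]] := supp u u1.
  by rewrite !dotpBl lerB ?ha ?hb.
split=> // u u1; have [x [y [Bx By hx hy wE]]] := supp u u1.
exists x => //; suff -> : x - w *: u = y by [].
apply/eqP; rewrite -subr_eq0 -dotp_eq0 eq_le dotp_ge0 andbT.
rewrite addrAC; move: (diam _ _ Bx By) wE; move: (x - y) => v hv vw.
rewrite dotpBl !dotpBr !dotpZl !dotpZr u1 (dotpC u) vw; lra.
Qed.

Lemma antipodal_constant_width B w : 0 <= w -> diameter_le B w -> antipodal B w ->
  has_constant_width B w.
Proof.
move=> w0 diam anti u /enorm_eq1 u1; have [x Bx By] := anti u u1.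
have bound a b : B a -> B b -> dotp (a - b) u <= w.
  by move=> Ba Bb; apply: le_trans (dotp_le_enorm _ u1) _; rewrite le_enorm// diam.
have xy : dotp (x - (x - w *: u)) u = w by rewrite opprB addrC subrK dotpZl u1 mulr1.
rewrite (@width_in_directionE B u x (x - w *: u))//.
- move=> z Bz; have := bound z _ Bz By; move: xy; rewrite !dotpBl; lra.
- move=> z Bz; have := bound x _ Bx Bz; move: xy; rewrite !dotpBl; lra.
Qed.

Lemma widthE B w : has_constant_width B w -> width B = w.
Proof.
move=> cw; have e1 := (enorm_eq1 _).2 unit_vec.
by rewrite -(cw _ e1) (@getPex _ [set v | has_constant_width B v] _ _ e1)//; exists w.
Qed.

End constant_width.

(** * Completion of a set to a body of constant width *)

Section completion.
Variable R : realType.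
Implicit Types (B C D : set 'rV[R]_3) (w : R).

(** One implication is the diameter bound, the other says that no point can be added; together, [C]
    is the intersection of the balls of radius [w] centred at its points. *)
Definition complete C w :=
  forall x, C x <-> forall y, C y -> dotp (x - y) (x - y) <= w ^+ 2.

(** Zorn's lemma. Adjoining [D] inside the predicate makes the union of every chain admissible, the
    empty chain included, and keeps [D] in the result. *)
Lemma exists_completion D w : diameter_le D w ->
  exists2 C, D `<=` C & complete C w.
Proof.
move=> diamD; pose P : set (set 'rV[R]_3) := [set A | diameter_le (D `|` A) w].
have sym (x y : 'rV[R]_3) : dotp (x - y) (x - y) = dotp (y - x) (y - x).
  by rewrite -opprB dotpNl dotpNr opprK.
have [|A [PA maxA]] := @Zorn_bigcup _ P.
  move=> F FP totF x y [Dx|[X FX Xx]] [Dy|[Y FY Yy]].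
  - exact: diamD.
  - by apply: (FP _ FY); [left|right].
  - by apply: (FP _ FX); [right|left].
  - have [XY|YX] := totF _ _ FX FY.
    + by apply: (FP _ FY); right => //; exact: XY.
    + by apply: (FP _ FX); right => //; exact: YX.
exists (D `|` A); first by left.
move=> x; split=> [Cx y Cy|H]; first exact: PA.
apply: contrapT => nCx; apply: (maxA (A `|` [set x])).
  split; last by move=> /(_ x) Ax; apply: nCx; right; apply: Ax; right.
  by move=> y Ay; left.
have P0 : dotp (x - x) (x - x) <= w ^+ 2.
  by rewrite subrr -[0](scale0r (0 : 'rV[R]_3)) dotpZl mul0r sqr_ge0.
move=> a b; rewrite setUA => -[Ca|->] [Cb|->] //.
- exact: PA.
- by rewrite sym; exact: H.
- exact: H.
Qed.

Lemma coord_le_dotp (z : 'rV[R]_3) w i : 0 <= w -> dotp z z <= w ^+ 2 -> `|z 0 i| <= w.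
Proof.
move=> w0 h; rewrite -(@ler_pXn2r _ 2)// ?nnegrE// real_normK ?num_real//.
apply: le_trans h; rewrite /dotp (bigD1 i)//= -expr2 lerDl.
by apply: sumr_ge0 => j _; rewrite -expr2 sqr_ge0.
Qed.

Lemma mx_norm_le_dotp (z : 'rV[R]_3) w : 0 <= w -> dotp z z <= w ^+ 2 -> `|z| <= w.
Proof.
move=> w0 h; rewrite [leLHS]/Num.norm /= mx_normrE; apply: bigmax_le => // -[i j] _ /=.
by rewrite (ord1 i); exact: coord_le_dotp.
Qed.

Lemma closed_dotp_ball (y : 'rV[R]_3) k : closed [set x | dotp (x - y) (x - y) <= k].
Proof.
have cf : continuous (fun x : 'rV[R]_3 => dotp (x - y) (x - y)).
  move=> x; rewrite (_ : (fun _ => _) = fun x : 'rV[R]_3 =>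
    ((x 0 0 - y 0 0) * (x 0 0 - y 0 0) + (x 0 1 - y 0 1) * (x 0 1 - y 0 1))
    + (x 0 2%:R - y 0 2%:R) * (x 0 2%:R - y 0 2%:R)); last first.
    by apply/funext => z; rewrite dotpE !mxE.
  have c i : (fun z : 'rV[R]_3 => z 0 i - y 0 i) z @[z --> x] --> x 0 i - y 0 i.
    have h := @coord_continuous R 1 3 0 i x.
    have := cvgB h (cvg_cst (y 0 i)); exact.
  have c2 i : (fun z : 'rV[R]_3 => (z 0 i - y 0 i) * (z 0 i - y 0 i)) z @[z --> x] -->
      (x 0 i - y 0 i) * (x 0 i - y 0 i).
    by have := cvgM (c i) (c i); exact.
  exact: cvgD (cvgD (c2 0) (c2 1)) (c2 2%:R).
rewrite (_ : [set x | _] = (fun x : 'rV[R]_3 => dotp (x - y) (x - y)) @^-1` [set r | r <= k]) //.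
by apply: preimage_closed => [x _|]; [exact: cf|exact: closed_le].
Qed.

Section complete_set.
Variables (C : set 'rV[R]_3) (w : R).
Hypotheses (w0 : 0 < w) (Cc : complete C w) (C0 : C !=set0).

Lemma complete_diameter : diameter_le C w.
Proof. by move=> x y /Cc; apply. Qed.

(** Stewart's theorem. The last term gives convexity of [C], and in [complete_antipodal] it measures
    how far a point of a chord can be pushed outwards. *)
Lemma sqr_dotp_conv (x y : 'rV[R]_3) (t : R) :
  dotp (t *: x + (1 - t) *: y) (t *: x + (1 - t) *: y) =
  t * dotp x x + (1 - t) * dotp y y - t * (1 - t) * dotp (x - y) (x - y).
Proof.
by rewrite !(dotpDl, dotpDr, dotpNl, dotpNr, dotpZl, dotpZr) (dotpC y x); ring.
Qed.

Lemma complete_conv (x y : 'rV[R]_3) (t : R) : 0 <= t -> t <= 1 ->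
  C x -> C y -> C (t *: x + (1 - t) *: y).
Proof.
move=> t0 t1 Cx Cy; apply/Cc => z Cz.
have -> : t *: x + (1 - t) *: y - z = t *: (x - z) + (1 - t) *: (y - z).
  by apply/rowP => i; rewrite !mxE; ring.
rewrite sqr_dotp_conv.
have h1 := ler_wpM2l t0 (complete_diameter Cx Cz).
have t1' : 0 <= 1 - t by rewrite subr_ge0.
have h2 := ler_wpM2l t1' (complete_diameter Cy Cz).
have h3 := mulr_ge0 (mulr_ge0 t0 t1') (dotp_ge0 (x - z - (y - z))).
lra.
Qed.

Lemma complete_closed : closed C.
Proof.
rewrite (_ : C = \bigcap_(y in C) [set x | dotp (x - y) (x - y) <= w ^+ 2]); last first.
  by apply/seteqP; split => x; [move/Cc|move=> H; apply/Cc].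
by apply: closed_bigI => y _; exact: closed_dotp_ball.
Qed.

Lemma complete_compact : compact C.
Proof.
apply: bounded_closed_compact; last exact: complete_closed.
have [c Cc0] := C0.
exists (`|c| + w); split; first by rewrite num_real.
move=> M HM x Cx; apply: le_trans (ltW HM).
rewrite -[x](subrK c) addrC; apply: le_trans (ler_normD _ _) _.
rewrite lerD2l; exact: mx_norm_le_dotp (ltW w0) (complete_diameter Cx Cc0).
Qed.

(* A complete set contains every minor arc of radius [w] joining two of its points, so
   that a support plane at [x] with outer normal [u] forces [C] into the ball of radius
   [w] centred at [x - w *: u]. *)
Lemma complete_antipodal : antipodal C w.
Proof.
move=> u u1; have [x Cx hx] := compact_support_point u complete_compact C0.
exists x => //; apply/Cc => p Cp.
have [e eE] : exists e, e = p - x by eexists.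
have eD : x - w *: u - p = - (e + w *: u) by rewrite eE; apply/rowP => i; rewrite !mxE; ring.
rewrite eD dotpNl dotpNr opprK dotpDl !dotpDr !dotpZl !dotpZr u1 (dotpC u).
(* This inequality is [|e + w u| <= w] expanded. *)
suff H : dotp e u <= - (dotp e e / (2 * w)).
  have := ler_wpM2l (ltW w0) H.
  rewrite mulrN (_ : w * (dotp e e / (2 * w)) = dotp e e / 2); last first.
    by field; rewrite gt_eqF.
  lra.
have E0 := dotp_ge0 e.
(* The point dividing the chord from [x] to [p] in ratio [t] has squared distance at most
   [w^2 - Q <= (w - tau)^2] to every point of [C], so it stays in [C] when moved by [tau] along [u].
   Its height is at most that of [x], which gives the bound; then [t] tends to 0. *)
have key t : 0 < t -> t < 1 -> dotp e u <= - ((1 - t) * (dotp e e / (2 * w))).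
  move=> t0 t1; pose Q := t * (1 - t) * dotp e e; pose tau := Q / (2 * w).
  have Q0 : 0 <= Q by rewrite !mulr_ge0// ?subr_ge0 ltW.
  have tau0 : 0 <= tau by rewrite divr_ge0// mulr_ge0// ltW.
  have tauE : 2 * w * tau = Q by rewrite /tau mulrC divfK// mulf_neq0// gt_eqF.
  have Cz : C (t *: p + (1 - t) *: x + tau *: u).
    apply/Cc => o Co.
    have [m mE] : exists m, m = t *: (p - o) + (1 - t) *: (x - o) by eexists.
    have -> : t *: p + (1 - t) *: x + tau *: u - o = m + tau *: u.
      by rewrite mE; apply/rowP => i; rewrite !mxE; ring.
    have mm : dotp m m <= w ^+ 2 - Q.
      rewrite mE sqr_dotp_conv (_ : p - o - (x - o) = e); last first.
        by rewrite eE; apply/rowP => i; rewrite !mxE; ring.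
      have h1 := ler_wpM2l (ltW t0) (complete_diameter Cp Co).
      have t1' : 0 <= 1 - t by rewrite subr_ge0 ltW.
      have h2 := ler_wpM2l t1' (complete_diameter Cx Co).
      rewrite /Q; lra.
    have m0 := dotp_ge0 m.
    have wtau : tau <= w.
      rewrite -(@ler_pM2l _ (2 * w)) ?mulr_gt0// tauE.
      have := sqr_ge0 w; lra.
    have mu : dotp m u <= w - tau.
      apply: le_trans (dotp_le_enorm m u1) _; rewrite le_enorm ?subr_ge0//.
      apply: le_trans mm _; rewrite sqrrB -tauE.
      have := sqr_ge0 tau; lra.
    rewrite dotpDl !dotpDr !dotpZl !dotpZr u1 (dotpC u).
    have := ler_wpM2l tau0 mu; have := sqr_ge0 tau; lra.
  have := hx _ Cz; rewrite !dotpDl !dotpZl u1 mulr1 => H.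
  have eu : dotp e u = dotp p u - dotp x u by rewrite eE dotpBl.
  have : t * dotp e u <= t * (- ((1 - t) * (dotp e e / (2 * w)))).
    rewrite (_ : t * - ((1 - t) * (dotp e e / (2 * w))) = - tau); first by rewrite eu; lra.
    by rewrite /tau /Q; field; rewrite gt_eqF.
  by rewrite ler_pM2l.
set b := dotp e e / (2 * w) in key *.
have b0 : 0 <= b by rewrite divr_ge0// mulr_ge0// ltW.
apply/ler_addgt0Pr => d d0.
pose t := d / (b + d + 1).
have den : 0 < b + d + 1 by lra.
have t0 : 0 < t by rewrite divr_gt0.
have t1 : t < 1 by rewrite ltr_pdivrMr//; lra.
have tb : t * b <= d.
  rewrite /t mulrAC ler_pdivrMr// ler_pM2l//; lra.
have := key t t0 t1; lra.
Qed.

End complete_set.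
End completion.

(** * The completed regular tetrahedron *)

Section competitor.
Variable R : realType.
Let mR := measurableTypeR R.

Lemma fine_le_real (a : \bar R) (r : R) : (0 <= a)%E -> (a <= r%:E)%E -> fine a <= r.
Proof. by case: a => [a| |]//=; rewrite lee_fin. Qed.

Definition tetra_vertices (w h : R) : set 'rV[R]_3 :=
  [set v | v = vec (w / 2) 0 h \/ v = vec (- (w / 2)) 0 h \/
           v = vec 0 (w / 2) (- h) \/ v = vec 0 (- (w / 2)) (- h)].

Lemma tetra_diameter (w h : R) : 8 * h ^+ 2 = w ^+ 2 -> diameter_le (tetra_vertices w h) w.
Proof.
move=> hw x y; have w2 := sqr_ge0 w.
by move=> [->|[->|[->|->]]] [->|[->|[->|->]]]; rewrite vecB dotp_vec; lra.
Qed.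

Lemma exists_tetra_body (w : R) : 0 < w -> exists2 C : set 'rV[R]_3,
  constant_width_body C /\ has_constant_width C w & volume C <= 1130 / 2560 * w ^+ 3.
Proof.
(* Vertices on different edges have squared distance [w^2 / 2 + 4 h^2], which is [w^2] for this
   [h]. *)
move=> w0; pose h := w * Num.sqrt 2 / 4.
have h0 : 0 < h by rewrite divr_gt0// mulr_gt0// sqrtr_gt0.
have hw : 8 * h ^+ 2 = w ^+ 2.
  by rewrite /h expr_div_n exprMn sqr_sqrtr//; field.
have [C DC Cc] := exists_completion (tetra_diameter hw).
have V1 : C (vec (w / 2) 0 h) by apply: DC; left.
have V2 : C (vec (- (w / 2)) 0 h) by apply: DC; right; left.
have V3 : C (vec 0 (w / 2) (- h)) by apply: DC; right; right; left.
have V4 : C (vec 0 (- (w / 2)) (- h)) by apply: DC; right; right; right.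
have C0 : C !=set0 by exists (vec (w / 2) 0 h).
have cC := complete_compact w0 Cc C0.
have clC := complete_closed Cc.
have diam := complete_diameter Cc.
have cwC : has_constant_width C w.
  by apply: antipodal_constant_width => //; [exact: ltW|exact: complete_antipodal].
have conv := complete_conv Cc.
exists C.
  split=> //; split; last by exists w.
  split=> //.
    move=> x y l; rewrite !inE => Cx Cy.
    have : C (l%:inum *: (x : 'rV[R]_3) + (1 - l%:inum) *: (y : 'rV[R]_3)).
      by apply: conv => //; rewrite ?ge0 ?le1.
    exact.
  exists (vec 0 0 0); apply/nbhs_ballP.
  (* A point near 0 is a convex combination, with weights [m] and [1 - m], of points on the two
     opposite edges. [|z| <= h / 2] puts [m] in [[1 / 4, 3 / 4]], and then [|x|, |y| <= w / 8] keep
     [x / m] and [y / (1 - m)] within the edges. *)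
  pose e := Num.min (h / 2) (w / 8).
  have e0 : 0 < e by rewrite lt_min; apply/andP; split; apply: divr_gt0.
  exists e => // p [_ bp].
  have cp i : `|p 0 i| <= e.
    have := bp 0 i; rewrite /ball /= => /ltW; rewrite [vec 0 0 0 0 i](_ : _ = 0) ?sub0r ?normrN//.
    by rewrite /vec /point3 mxE; case: i => -[|[|[|//]]].
  have eh : e <= h / 2 by rewrite ge_min lexx.
  have ew : e <= w / 8 by rewrite ge_min lexx orbT.
  rewrite [p]vecP.
  move: (cp 0) (cp 1) (cp 2%:R); move: (p 0 0) (p 0 1) (p 0 2%:R) => x y z hx hy hz.
  have edge (a : R) (v v' : 'rV[R]_3) : C v -> C v' -> `|a| <= w / 2 ->
      C ((1 / 2 + a / w) *: v + (1 - (1 / 2 + a / w)) *: v').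
    move=> Cv Cv'; rewrite ler_norml => /andP[a1 a2]; apply: conv => //.
      have : - (1 / 2) <= a / w by rewrite ler_pdivlMr//; lra.
      lra.
    have : a / w <= 1 / 2 by rewrite ler_pdivrMr//; lra.
    lra.
  have [m mE] : exists m, m = (1 + z / h) / 2 by eexists.
  have [m1 m2] : 1 / 4 <= m /\ m <= 3 / 4.
    have z1 : - (1 / 2) <= z / h by move: hz; rewrite ler_norml ler_pdivlMr// => /andP[? ?]; lra.
    have z2 : z / h <= 1 / 2 by move: hz; rewrite ler_norml ler_pdivrMr// => /andP[? ?]; lra.
    by rewrite mE; lra.
  have m0 : 0 < m by lra.
  have m1' : 0 < 1 - m by lra.
  have q1 : `|x / m| <= w / 2.
    rewrite normrM normfV (gtr0_norm m0) ler_pdivrMr//.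
    have : w / 2 * (1 / 4) <= w / 2 * m by rewrite ler_pM2l// divr_gt0.
    lra.
  have q2 : `|y / (1 - m)| <= w / 2.
    rewrite normrM normfV (gtr0_norm m1') ler_pdivrMr//.
    have : w / 2 * (1 / 4) <= w / 2 * (1 - m) by rewrite ler_pM2l ?divr_gt0//; lra.
    lra.
  have := conv _ _ m (ltW m0) (ltac:(lra)) (edge _ _ _ V1 V2 q1) (edge _ _ _ V3 V4 q2).
  rewrite !(vecZ, vecD).
  set X := (X in vec X _ _); set Y := (X in vec _ X _); set Z := (X in vec _ _ X).
  have -> : X = x by rewrite /X; field; rewrite !gt_eqF.
  have -> : Y = y by rewrite /Y; field; rewrite !gt_eqF.
  have -> : Z = z.
    have -> : Z = (2 * m - 1) * h by rewrite /Z; ring.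
    have -> : 2 * m - 1 = z / h by rewrite mE; field; rewrite gt_eqF.
    by rewrite divfK// gt_eqF.
  by [].
apply: fine_le_real; first exact: measure_ge0.
apply: (lebesgue3_tetra_le w0 (ltW h0) hw); first exact: measurable_point3_closed.
move=> x y z Cxyz.
have d v1 v2 v3 : C (vec v1 v2 v3) ->
    (x - v1) ^+ 2 + (y - v2) ^+ 2 + (z - v3) ^+ 2 <= w ^+ 2.
  by move=> Cv; have := diam _ _ Cxyz Cv; rewrite -[point3 _]/(vec x y z) vecB dotp_vec -!expr2.
have d1 := d _ _ _ V1; have d2 := d _ _ _ V2; have d3 := d _ _ _ V3; have d4 := d _ _ _ V4.
(* The farther of the two vertices on an edge gives [(|x| + w / 2)^2] in place of [x^2 + w * |x|],
   or the same with [y]. *)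
by split; [case: (ger0P x)|case: (ger0P y)] => _; lra.
Qed.

End competitor.

(** * The volume of a body of revolution *)

Section revolution.
Variable R : realType.
Let mR := measurableTypeR R.
Variables (S : set 'rV[R]_3) (w : R).
Hypotheses (w0 : 0 < w) (mS : measurable (@point3 R @^-1` S)).
Hypothesis finS : (lebesgue3 (@point3 R @^-1` S) < +oo)%E.
Hypothesis convS : forall (x y : 'rV[R]_3) k, 0 <= k -> k <= 1 -> S x -> S y ->
  S (k *: x + (1 - k) *: y).
Hypotheses (diamS : diameter_le S w) (antiS : antipodal S w).
Hypothesis rotS : forall x y z x' y', S (vec x y z) ->
  x' ^+ 2 + y' ^+ 2 = x ^+ 2 + y ^+ 2 -> S (vec x' y' z).

Lemma segment_mem (f : R -> 'rV[R]_3) (a b x : R) :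
  (forall k, f (k * a + (1 - k) * b) = k *: f a + (1 - k) *: f b) ->
  a <= x -> x <= b -> S (f a) -> S (f b) -> S (f x).
Proof.
move=> Hf ax xb Sa Sb; have [ab|aNb] := eqVneq a b.
  by rewrite (_ : x = a)//; apply/eqP; rewrite eq_le ax ab xb.
have lab : 0 < b - a by rewrite subr_gt0 lt_neqAle aNb (le_trans ax).
have -> : x = ((b - x) / (b - a)) * a + (1 - (b - x) / (b - a)) * b.
  by field; rewrite gt_eqF.
rewrite Hf; apply: convS => //.
  by rewrite divr_ge0 ?subr_ge0 ?(ltW lab)// -subr_ge0 (ltW lab).
by rewrite ler_pdivrMr// mul1r lerD2l lerN2.
Qed.

(** Rotation gives the circle of radius [r], and its chords parallel to the first axis fill the
    disc. *)
Lemma disc_mem (r x y z : R) : 0 <= r -> S (vec r 0 z) -> x ^+ 2 + y ^+ 2 <= r ^+ 2 ->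
  S (vec x y z).
Proof.
move=> r0 Sr xy; pose x0 := Num.sqrt (r ^+ 2 - y ^+ 2).
have x02 : x0 ^+ 2 = r ^+ 2 - y ^+ 2.
  by rewrite sqr_sqrtr//; have := sqr_ge0 x; lra.
have xx0 : `|x| <= x0.
  rewrite -(@ler_pXn2r _ 2)// ?nnegrE ?sqrtr_ge0// real_normK ?num_real// x02; lra.
move: xx0; rewrite ler_norml => /andP[x1 x2].
apply: (@segment_mem (fun x => vec x y z) (- x0) x0) => //.
- by move=> k; rewrite !vecZ vecD; congr vec; ring.
- by apply: rotS Sr _; rewrite sqrrN x02; ring.
- by apply: rotS Sr _; rewrite x02; ring.
Qed.

Lemma cylinder_mem (r t t' x y z : R) : 0 <= r -> S (vec r 0 t) -> S (vec r 0 t') ->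
  t <= z -> z <= t' -> x ^+ 2 + y ^+ 2 <= r ^+ 2 -> S (vec x y z).
Proof.
move=> r0 St St' tz zt' xy.
apply: (@segment_mem (fun z => vec x y z) t t') => //.
- by move=> k; rewrite !vecZ vecD; congr vec; ring.
- exact: disc_mem St xy.
- exact: disc_mem St' xy.
Qed.

Lemma antipodal_support (u x y : 'rV[R]_3) : dotp u u = 1 -> S x -> S (x - w *: u) -> S y ->
  dotp (x - w *: u) u <= dotp y u <= dotp x u.
Proof.
move=> u1 Sx Sx' Sy.
have bound a b : S a -> S b -> dotp (a - b) u <= w.
  by move=> Sa Sb; apply: le_trans (dotp_le_enorm _ u1) _; rewrite le_enorm ?(ltW w0)// diamS.
have := bound _ _ Sx Sy; have := bound _ _ Sy Sx'.
by rewrite !dotpBl dotpZl u1; lra.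
Qed.

Let c (s : R) : R := Num.sqrt (1 - s ^+ 2).

Lemma half_profile_point (s : R) : 0 < s -> s < 1 -> exists p : R * R,
  [/\ 0 <= p.1 <= c s, p.1 <= 1 / 2, c s - p.1 <= 1 / 2,
    S (vec (w * p.1) 0 (w * p.2)) & S (vec (w * (p.1 - c s)) 0 (w * (p.2 - s)))].
Proof.
move=> s0 s1.
have c2 : c s ^+ 2 = 1 - s ^+ 2 by rewrite sqrt_subr1_sqr// ltW.
have c0 : 0 < c s by rewrite sqrtr_gt0 subr_gt0 expr_lt1// ltW.
pose u := vec (c s) 0 s.
have u1 : dotp u u = 1 by rewrite dotp_vec -!expr2 c2; ring.
have [x Sx Sx'] := antiS u1.
have supp y : S y -> _ := antipodal_support u1 Sx Sx'.
move: supp Sx Sx'; rewrite [x]vecP.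
move: (x 0 0) (x 0 1) (x 0 2%:R) => x1 x2 x3 supp Sx Sx'.
(* Rotating the support point into the half-plane of [u] cannot raise its height in direction [u],
   so it already lies there. *)
have x1E : x1 = Num.sqrt (x1 ^+ 2 + x2 ^+ 2) /\ x2 = 0.
  set r := Num.sqrt _.
  have r0 : 0 <= r by exact: sqrtr_ge0.
  have r2 : r ^+ 2 = x1 ^+ 2 + x2 ^+ 2 by rewrite sqr_sqrtr// addr_ge0 ?sqr_ge0.
  have Sr : S (vec r 0 x3) by apply: rotS Sx _; rewrite r2; ring.
  have /andP[_] := supp _ Sr; rewrite !dotp_vec => h.
  have rx : r <= x1 by rewrite -(ler_pM2l c0); lra.
  have x1r : x1 <= r.
    by rewrite -(@ler_pXn2r _ 2)// ?nnegrE ?(le_trans r0 rx)// r2 lerDl sqr_ge0.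
  have E : x1 = r by apply/eqP; rewrite eq_le rx x1r.
  by split => //; apply/eqP; rewrite -sqrf_eq0; apply/eqP; move: r2; rewrite -E; lra.
have [x1r x20] := x1E; rewrite x20 in Sx Sx' supp.
have x10 : 0 <= x1 by rewrite x1r sqrtr_ge0.
move: Sx'; rewrite /u vecZ vecB => Sx'.
have SxN : S (vec (- x1) 0 x3) by apply: rotS Sx _; ring.
have Sx'N : S (vec (w * c s - x1) 0 (x3 - w * s)).
  by move: Sx'; rewrite mulr0 subr0 => /rotS; apply; ring.
(* The mirror image of the antipode cannot lie below the antipode in direction [u]. *)
have xwc : x1 <= w * c s.
  have /andP[+ _] := supp _ Sx'N; rewrite /u vecZ vecB !dotp_vec => h.
  rewrite -(ler_pM2l c0); lra.
(* Mirror images across the axis are at most [w] apart. *)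
have half a z : 0 <= a -> S (vec a 0 z) -> S (vec (- a) 0 z) -> a <= w / 2.
  move=> a0 h1 h2; have := diamS h1 h2; rewrite vecB dotp_vec => h.
  rewrite -(@ler_pXn2r _ 2)// ?nnegrE ?divr_ge0 ?(ltW w0)// expr_div_n; lra.
exists (x1 / w, x3 / w) => /=.
have wN : w != 0 by rewrite gt_eqF.
split.
- by rewrite divr_ge0 ?(ltW w0)//= ler_pdivrMr// mulrC.
- have := half _ _ x10 Sx SxN; rewrite ler_pdivrMr//; lra.
- have h1 : 0 <= w * c s - x1 by rewrite subr_ge0.
  have Sx'' : S (vec (- (w * c s - x1)) 0 (x3 - w * s)).
    by rewrite opprB; move: Sx'; rewrite mulr0 subr0.
  have h := half _ _ h1 Sx'N Sx''.
  rewrite lerBlDr -(ler_pM2l w0) mulrDr (mulrC _ (x1 / w)) divfK//; lra.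
- by rewrite !(mulrC w) !divfK.
- move: Sx'; rewrite mulr0 subr0.
  by rewrite !mulrBr !(mulrC w (_ / w)) !divfK.
Qed.

(** As [s] grows, the slab [V s] gains a layer at the top and one at the bottom, and each contains a
    cylinder over the smaller of its end discs. This gives the increment condition of
    [profile_bound]; in [k] the factor [313 / 100] stands for pi. *)
Lemma revolution_volume : ((313 / 100 * (353 / 2500) * w ^+ 3)%:E <=
  lebesgue3 (@point3 R @^-1` S))%E.
Proof.
have [P HP] : exists P : R -> R * R, forall s, 0 < s -> s < 1 ->
  [/\ 0 <= (P s).1 <= c s, (P s).1 <= 1 / 2, c s - (P s).1 <= 1 / 2,
    S (vec (w * (P s).1) 0 (w * (P s).2)) &
    S (vec (w * ((P s).1 - c s)) 0 (w * ((P s).2 - s)))].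
  have : forall s : R, exists p : R * R, 0 < s -> s < 1 ->
    [/\ 0 <= p.1 <= c s, p.1 <= 1 / 2, c s - p.1 <= 1 / 2,
    S (vec (w * p.1) 0 (w * p.2)) & S (vec (w * (p.1 - c s)) 0 (w * (p.2 - s)))].
    move=> s; have [s0|s0] := ltP 0 s; last by exists (0, 0).
    have [s1|s1] := ltP s 1; last by exists (0, 0).
    by have [p] := half_profile_point s0 s1; exists p.
  by move=> /choice[P]; exists P.
pose a s := (P s).1; pose t s := (P s).2.
pose slab s : set (mR * mR * mR) := setT `*` `[w * (t s - s), w * t s[%classic.
pose V s := (@point3 R @^-1` S) `&` slab s.
have mV s : measurable (V s).
  by apply: measurableI => //; apply: measurableX => //; exact: measurable_itv.
have VS s : V s `<=` @point3 R @^-1` S by exact: subIsetl.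
have finV s : lebesgue3 (V s) \is a fin_num.
  rewrite ge0_fin_numE//; apply: le_lt_trans finS.
  by apply: le_measure; rewrite ?inE.
pose k := 313 / 100 * w ^+ 3.
have k0 : 0 < k by apply: mulr_gt0; [lra|exact: exprn_gt0].
pose Phi s := fine (lebesgue3 (V s)) / k.
have bound := @profile_bound R a t Phi.
suff H : 353 / 2500 <= Phi (99 / 100).
  apply: (@le_trans _ _ (lebesgue3 (V (99 / 100)))); last first.
    by apply: le_measure; rewrite ?inE.
  rewrite -(fineK (finV _)) lee_fin.
  by move: H; rewrite /Phi ler_pdivlMr// /k; lra.
apply: bound.
- move=> s s0 s1; have [h1 h2 h3 _ _] := HP s s0 s1; split => //.
  by rewrite divr_ge0 ?(ltW k0)// fine_ge0.
- move=> s s' s0 s1 s0' s1'.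
  have [_ _ _ Sp Sq] := HP s s0 s1; have [_ _ _ Sp' Sq'] := HP s' s0' s1'.
  have u1 : dotp (vec (c s) 0 s) (vec (c s) 0 s) = 1.
    by rewrite dotp_vec -!expr2 sqrt_subr1_sqr ?ltW//; ring.
  have Sq2 : S (vec (w * (P s).1) 0 (w * (P s).2) - w *: vec (c s) 0 s).
    by move: Sq; rewrite vecZ vecB mulr0 subr0 !mulrBr.
  have /andP[_ h1] := antipodal_support u1 Sp Sq2 Sp'.
  have /andP[h2 _] := antipodal_support u1 Sp Sq2 Sq'.
  move: h1 h2; rewrite vecZ vecB !dotp_vec => h1 h2.
  by split; rewrite -(ler_pM2l w0) /a /t -/(c s) -/(c s'); lra.
- move=> s s' s0 ss' s1' aa tt qq uu.
  have s1 : s < 1 by rewrite (lt_trans ss').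
  have s0' : 0 < s' by rewrite (lt_trans s0).
  have [ha _ _ Sp Sq] := HP s s0 s1; have [ha' _ _ Sp' Sq'] := HP s' s0' s1'.
  rewrite -/(a s) -/(a s') -/(t s) -/(t s') -/(c s) -/(c s') in ha ha' Sp Sq Sp' Sq' aa tt qq uu *.
  have /andP[a0 ac] := ha; have /andP[a0' ac'] := ha'.
  (* The radii are those at [s'], the smaller ones because [a] and [c - a] decrease. Half-open
     heights make the layers disjoint from [V s]. *)
  pose C1 : set (mR * mR * mR) := disc (w * a s') `*` `[w * t s, w * t s'[%classic.
  pose C2 : set (mR * mR * mR) :=
    disc (w * (c s' - a s')) `*` `[w * (t s' - s'), w * (t s - s)[%classic.
  have wa' : 0 <= w * a s' by rewrite mulr_ge0// ltW.
  have wc' : 0 <= w * (c s' - a s') by rewrite mulr_ge0 ?subr_ge0// ltW.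
  have wtt : w * t s <= w * t s' by rewrite ler_pM2l.
  have wuu : w * (t s' - s') <= w * (t s - s) by rewrite ler_pM2l//; lra.
  have wts : w * (t s - s) <= w * t s by rewrite ler_pM2l//; lra.
  have mC1 : measurable C1 by apply: measurableX; [exact: measurable_disc|exact: measurable_itv].
  have mC2 : measurable C2 by apply: measurableX; [exact: measurable_disc|exact: measurable_itv].
  have cyl (r z1 z2 : R) : 0 <= r -> z1 <= z2 ->
      ((313 / 100 * r ^+ 2 * (z2 - z1))%:E <= lebesgue3 (disc r `*` `[z1, z2[%classic))%E.
    move=> r0 z12; rewrite lebesgue3_box; last exact: measurable_itv; last exact: measurable_disc.
    rewrite lebesgue_measure_itv /= lte_fin; case: ltP => z12'.
      rewrite -EFinB EFinM; apply: lee_pmul.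
      - by rewrite lee_fin; apply: mulr_ge0; [lra|exact: sqr_ge0].
      - by rewrite lee_fin subr_ge0.
      - exact: lebesgue2_disc_ge.
      - by [].
    have -> : z1 = z2 by apply/eqP; rewrite eq_le z12 z12'.
    by rewrite subrr mulr0 mule0.
  have C1S : C1 `<=` V s'.
    move=> [[x y] z] [/= xy]; rewrite in_itv /= => /andP[z1 z2]; split; last first.
      by split => //=; rewrite in_itv /= z2 andbT; lra.
    apply: (@cylinder_mem (w * a s') (w * t s) (w * t s')) => //; last exact: ltW.
    apply: disc_mem Sp _; first by rewrite mulr_ge0// ltW.
    rewrite expr0n addr0 lerXn2r// ?nnegrE ?mulr_ge0 ?(ltW w0)//.
    by rewrite ler_pM2l.
  have flip x z : S (vec (w * x) 0 z) -> S (vec (w * (- x)) 0 z).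
    by move=> h; apply: rotS h _; ring.
  have C2S : C2 `<=` V s'.
    move=> [[x y] z] [/= xy]; rewrite in_itv /= => /andP[z1 z2]; split; last first.
      by split => //=; rewrite in_itv /= z1 /=; lra.
    move: Sq Sq' => /flip Sq /flip Sq'; rewrite !opprB in Sq Sq'.
    apply: (@cylinder_mem (w * (c s' - a s')) (w * (t s' - s')) (w * (t s - s))) => //;
      last exact: ltW.
    apply: disc_mem Sq _; first by rewrite mulr_ge0 ?subr_ge0// ltW.
    rewrite expr0n addr0 lerXn2r// ?nnegrE ?mulr_ge0 ?(ltW w0) ?subr_ge0//.
    by rewrite ler_pM2l.
  have VV : V s `<=` V s'.
    move=> [[x y] z] [Sx [_ /=]]; rewrite in_itv /= => /andP[z1 z2]; split => //.
    by split => //=; rewrite in_itv /=; apply/andP; split; lra.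
  have dis1 : V s `&` C1 = set0.
    rewrite -subset0 => -[[x y] z] [[_ [_ /=]]]; rewrite in_itv /= => /andP[_ h].
    by case=> /= _; rewrite in_itv /= leNgt h.
  have dis2 : (V s `|` C1) `&` C2 = set0.
    rewrite -subset0 => -[[x y] z] [[[_ [_ /=]]|[/= _]]]; rewrite in_itv /= => /andP[h _];
    by case=> /= _; rewrite in_itv /= => /andP[_]; rewrite ltNge ?h ?(le_trans wts h).
  have := measureU (@lebesgue3 R) (measurableU _ _ (mV s) mC1) mC2 dis2.
  rewrite (measureU (@lebesgue3 R) (mV s) mC1 dis1) => E.
  have : (lebesgue3 (V s `|` C1 `|` C2) <= lebesgue3 (V s'))%E.
    apply: le_measure; rewrite ?inE//; last by rewrite !subUset.
    by apply: measurableU => //; exact: measurableU.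
  rewrite E => {}E.
  have c1 := cyl _ _ _ wa' wtt; have c2 := cyl _ _ _ wc' wuu.
  have : (lebesgue3 (V s) + (313 / 100 * (w * a s') ^+ 2 * (w * t s' - w * t s))%:E
     + (313 / 100 * (w * (c s' - a s')) ^+ 2 * (w * (t s - s) - w * (t s' - s')))%:E
     <= lebesgue3 (V s'))%E := le_trans (leeD (leeD (lexx _) c1) c2) E.
  rewrite -(fineK (finV s)) -(fineK (finV s')) -!EFinD lee_fin => F.
  rewrite /Phi ler_pdivlMr// mulrDl divfK ?gt_eqF//.
  apply: le_trans F; rewrite le_eqVlt; apply/orP; left; apply/eqP.
  by rewrite /k; field.
Qed.

End revolution.

(** * Reduction to a vertical axis and comparison of the volumes *)

Section final.
Variable R : realType.
Let mR := measurableTypeR R.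

Lemma lebesgue3_cube (M : R) : 0 <= M ->
  lebesgue3 ((cabs 0 M `*` cabs 0 M) `*` cabs 0 M) = ((2 * M) ^+ 3)%:E.
Proof.
move=> M0; have mc := measurable_cabs M (lexx (0 : R)).
have E : lebesgue_measure (cabs 0 M) = (2 * M)%:E.
  rewrite cabsE// oppr0 -[_ `|` _](_ : `[- M, M]%classic = _); last first.
    by apply/seteqP; split => x /=; rewrite !in_itv /=;
      [case: (lerP 0 x) => h /andP[? ?]; [left|right]; lra|case=> /andP[? ?]; lra].
  rewrite lebesgue_itvcc max_r; last by lra.
  by congr EFin; ring.
rewrite lebesgue3_box//; last exact: measurableX.
by rewrite lebesgue2_box// E -!EFinM; congr EFin; ring.
Qed.

Lemma measurable_cube (M : R) :
  measurable ((cabs 0 M `*` cabs 0 M) `*` cabs 0 M : set (mR * mR * mR)).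
Proof.
have mc := measurable_cabs M (lexx (0 : R)).
by apply: measurableX => //; exact: measurableX.
Qed.

Lemma lebesgue3_bounded (A : set (mR * mR * mR)) (M : R) : measurable A -> 0 <= M ->
  (forall x y z, A (x, y, z) -> [/\ `|x| <= M, `|y| <= M & `|z| <= M]) ->
  (lebesgue3 A < +oo)%E.
Proof.
move=> mA M0 H.
apply: (@le_lt_trans _ _ (lebesgue3 ((cabs 0 M `*` cabs 0 M) `*` cabs 0 M))).
  apply: le_measure; rewrite ?inE//; first exact: measurable_cube.
  move=> [[x y] z] /H[hx hy hz].
  by split; [split|]; rewrite /cabs /= ?normr_ge0 ?hx ?hy ?hz.
by rewrite lebesgue3_cube// ltry.
Qed.

Lemma compact_lebesgue3_fin (B : set 'rV[R]_3) : compact B ->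
  (lebesgue3 (@point3 R @^-1` B) < +oo)%E.
Proof.
move=> cB; have [M [Mr HM]] := compact_bounded cB.
have mB : measurable (@point3 R @^-1` B).
  by apply: measurable_point3_closed; apply: compact_closed cB; exact: norm_hausdorff.
pose N := `|M| + 1.
have N0 : 0 <= N by rewrite addr_ge0.
have MN : M < N by rewrite (le_lt_trans (ler_norm _))// ltrDl.
apply: (lebesgue3_bounded mB N0) => x y z Bxyz.
have hB := HM N MN _ Bxyz.
have coord i : `|vec x y z 0 i| <= N.
  apply: le_trans hB; rewrite [leRHS]/Num.norm /= mx_normrE.
  by apply/bigmax_geP; right; exists (0, i).
by have := coord 0; have := coord 1; have := coord 2%:R; rewrite !vecE.
Qed.

(** This allows the common denominator of the two ratios to be cancelled. The ball contains the cube
    of half-side [r / 2], as [3 (r / 2)^2 <= r^2]. *)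
Lemma volume_eball_gt0 (r : R) : 0 < r -> 0 < volume (eball (0 : 'rV[R]_3) r).
Proof.
move=> r0.
have E : eball (0 : 'rV[R]_3) r = [set x | dotp (x - 0) (x - 0) <= r ^+ 2].
  by apply/seteqP; split => x; rewrite /eball /= le_enorm// ltW.
have mB : measurable (@point3 R @^-1` eball 0 r).
  by rewrite E; apply: measurable_point3_closed; exact: closed_dotp_ball.
have fin : (lebesgue3 (@point3 R @^-1` eball 0 r) < +oo)%E.
  apply: (lebesgue3_bounded mB (ltW r0)) => x y z.
  rewrite E /= subr0 => h; have c i := coord_le_dotp i (ltW r0) h.
  by have := c 0; have := c 1; have := c 2%:R; rewrite -[point3 _]/(vec x y z) !vecE.
suff pos : (0 < lebesgue3 (@point3 R @^-1` eball 0 r))%E.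
  by apply: fine_gt0; apply/andP; split; [exact: pos|exact: fin].
apply: (@lt_le_trans _ _ (lebesgue3 ((cabs 0 (r / 2) `*` cabs 0 (r / 2)) `*` cabs 0 (r / 2)))).
  by rewrite lebesgue3_cube ?divr_ge0 ?(ltW r0)// lte_fin exprn_gt0// mulr_gt0// divr_gt0.
apply: le_measure; rewrite ?inE//; first exact: measurable_cube.
move=> [[x y] z] [[]]; rewrite /cabs /= => /andP[_ hx] /andP[_ hy] /andP[_ hz].
rewrite E /= subr0 -[point3 _]/(vec x y z) dotp_vec -!expr2.
have sq (u : R) : `|u| <= r / 2 -> u ^+ 2 <= (r / 2) ^+ 2.
  by move=> hu; rewrite -[u ^+ 2]real_normK ?num_real// lerXn2r// nnegrE ?divr_ge0 ?(ltW r0).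
have := sq _ hx; have := sq _ hy; have := sq _ hz; have := sqr_ge0 r.
rewrite expr_div_n; lra.
Qed.

Lemma dotp_orthogonal (Q : 'M[R]_3) (x y : 'rV[R]_3) : Q *m Q^T = 1%:M ->
  dotp (x *m Q) (y *m Q) = dotp x y.
Proof.
move=> QQ; have E (a b : 'rV[R]_3) : dotp a b = (a *m b^T) 0 0.
  by rewrite /dotp mxE; apply: eq_bigr => i _; rewrite mxE.
by rewrite !E trmx_mul mulmxA -(mulmxA x) QQ mulmx1.
Qed.

Lemma constant_width_gt0 (B : set 'rV[R]_3) w : 0 <= w -> diameter_le B w ->
  interior B !=set0 -> 0 < w.
Proof.
move=> w0 diam [x /nbhs_ballP[e /= e0 eB]].
rewrite lt_neqAle w0 andbT eq_sym; apply/eqP => wE.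
have Bx : B x by apply: eB; exact: ballxx.
have By : B (x + vec 0 0 (e / 2)).
  apply: eB; split => // i j; rewrite (ord1 i) /ball /= !mxE opprD addrA subrr sub0r normrN.
  case: j => -[|[|[|//]]] h /=; rewrite ?normr0//.
  rewrite gtr0_norm ?divr_gt0//; lra.
have := diam _ _ By Bx; rewrite addrAC subrr add0r dotp_vec wE.
have : 0 < e ^+ 2 by rewrite exprn_gt0.
lra.
Qed.

Lemma body_of_revolution_volume (B : set 'rV[R]_3) w :
  body_of_revolution B -> has_constant_width B w ->
  0 < w /\ 313 / 100 * (353 / 2500) * w ^+ 3 <= volume B.
Proof.
move=> [[cB convB intB] [p [v [vN0 rotB]]]] cw.
have B0 : B !=set0 by have [x /interior_subset Bx] := intB; exists x.
have [w0' diam anti] := constant_width_antipodal cB B0 cw.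
have w0 := constant_width_gt0 w0' diam intB.
split=> //.
have [Q [QQ]] := exists_frame vN0; move=> [k vE] volO.
have QQ' : Q^T *m Q = 1%:M by apply: mulmx1C.
have clB : closed B by apply: compact_closed cB; exact: norm_hausdorff.
have [mS SE] := volO p B clB.
have finB := compact_lebesgue3_fin cB.
suff : ((313 / 100 * (353 / 2500) * w ^+ 3)%:E <= lebesgue3 (@point3 R @^-1` B))%E.
  have fB : lebesgue3 (@point3 R @^-1` B) \is a fin_num by rewrite ge0_fin_numE.
  by rewrite -(fineK fB) lee_fin.
rewrite -SE; apply: (revolution_volume w0 mS).
- by rewrite SE.
- move=> x y l l0 l1 Sx Sy; rewrite /=.
  have -> : p + (l *: x + (1 - l) *: y) *m Q = l *: (p + x *m Q) + (1 - l) *: (p + y *m Q).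
    rewrite mulmxDl -!scalemxAl !scalerDr addrACA -scalerDl.
    by rewrite (addrC l) subrK scale1r.
  have l01 : Itv.spec (@Itv.num_sem R) (Itv.Real `[0%Z, 1%Z]) l.
    by rewrite /= /Itv.num_sem /= num_real /= in_itv /= l0 l1.
  pose lambda := Itv.Def l01.
  have := convB (p + x *m Q) (p + y *m Q) lambda.
  by rewrite !inE => /(_ Sx Sy).
- move=> x y Sx Sy; have := diam _ _ Sx Sy.
  by rewrite opprD addrACA subrr add0r -mulmxBl dotp_orthogonal.
- move=> u u1; have uO1 : dotp (u *m Q) (u *m Q) = 1 by rewrite dotp_orthogonal.
  have [b Bb Bb'] := anti _ uO1.
  have bE : p + (b - p) *m Q^T *m Q = b by rewrite -mulmxA QQ' mulmx1 addrC subrK.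
  exists ((b - p) *m Q^T); first by rewrite /= bE.
  by rewrite /= mulmxBl addrA bE -scalemxAl.
move=> x y z x' y' Sxyz r2E.
have [r0|rN0] := eqVneq (x ^+ 2 + y ^+ 2) 0.
  have z2 (a b : R) : a ^+ 2 + b ^+ 2 = 0 -> a = 0 /\ b = 0.
    by move/eqP; rewrite paddr_eq0 ?sqr_ge0// !sqrf_eq0 => /andP[/eqP -> /eqP ->].
  have [x0 y0] := z2 _ _ r0; have [x0' y0'] := z2 _ _ (etrans r2E r0).
  by move: Sxyz; rewrite x0 y0 x0' y0'.
(* Cosine and sine of the angle from [(x, y)] to [(x', y')], undefined on the axis, which was
   treated above. *)
pose c := (x * x' + y * y') / (x ^+ 2 + y ^+ 2).
pose s := (x * y' - y * x') / (x ^+ 2 + y ^+ 2).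
have cs : c ^+ 2 + s ^+ 2 = 1.
  rewrite !expr_div_n -mulrDl.
  rewrite (_ : (x * x' + y * y') ^+ 2 + (x * y' - y * x') ^+ 2 =
    (x ^+ 2 + y ^+ 2) * (x' ^+ 2 + y' ^+ 2)); last by ring.
  by rewrite r2E -expr2 divff// sqrf_eq0.
have rotE : vec x y z *m rotXYmx c s = vec x' y' z.
  by rewrite vec_rotXYmx /c /s; congr vec; field.
(* The rotation about the third axis, carried back to the axis spanned by [v]. *)
pose A := Q^T *m rotXYmx c s *m Q.
have rA : rotation_matrix_about v A.
  split.
  - rewrite /A !trmx_mul trmxK !mulmxA -(mulmxA _ Q Q^T) QQ mulmx1.
    by rewrite -(mulmxA Q^T) rotXYmx_orthogonal// mulmx1.
  - rewrite /A !det_mulmx det_rotXYmx// mulr1 -det_mulmx QQ' det1.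
    by [].
  - rewrite vE /A -!scalemxAl !mulmxA -(mulmxA _ Q Q^T) QQ mulmx1 vec_rotXYmx.
    by congr (_ *: (vec _ _ _ *m _)); ring.
have := rotB A rA; move=> /seteqP[+ _] => /(_ (p + vec x' y' z *m Q)); apply.
exists (p + vec x y z *m Q) => //.
rewrite (addrC p (vec x y z *m Q)) addrK /A !mulmxA -(mulmxA _ Q Q^T) QQ mulmx1 rotE.
by [].
Qed.

End final.

Theorem mainTheorem2 (R : realType) (B : set 'rV[R]_3) :
  constant_width_body B ->
  (forall B' : set 'rV[R]_3,
      constant_width_body B' -> volume_ratio B <= volume_ratio B') ->
  ~ body_of_revolution B.
Proof.
move=> [_ [w cw]] minB revB.
have [w0 lowB] := body_of_revolution_volume revB cw.
have [C [cwC cwCw] upC] := exists_tetra_body w0.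
have w2 : 0 < w / 2 by rewrite divr_gt0.
have := minB C cwC; rewrite /volume_ratio (widthE cw) (widthE cwCw).
(* Both bodies have width [w], so comparing ratios is comparing volumes. *)
rewrite ler_pM2r ?invr_gt0 ?volume_eball_gt0// => BC.
have w3 : 0 < w ^+ 3 by rewrite exprn_gt0.
have := le_trans lowB (le_trans BC upC); lra.
Qed.
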